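(* For any positive integer $m$ and strict partition $\lambda=(\lambda_1>\cdots>\lambda_k)$, \[ |\mathit{SPP}(m;\lambda;q,t)|^2=\det \Big[\operatorname{M}(q,t)\,U_{m+k}\,\operatorname{M}(q,t)^T\Big], \] where $\operatorname{M}(q,t)=\Big[t^{m+i-j}\begin{bmatrix}\lambda_i-1+m+i-j\\ m+i-j\end{bmatrix}_q\Big]_{1\le i\le k,\ 1\le j\le m+k}$ and $U_{m+k}=[d_{i,j}]_{1\le i,j\le m+k}$ with $d_{i,j}=2$ if $i<j$, $d_{i,i}=1$, $d_{i,j}=0$ if $i>j$. In particular, \[ |\mathit{SPP}(m;\lambda;q)|^2=\det \Big[\operatorname{M}(q,q)U_{m+k}\operatorname{M}(q,q)^T\Big]\quad\text{and}\quad |\mathit{PP}_{sym}(m;\overline{\lambda};q)|^2=\det \Big[\operatorname{M}(q^2,q)U_{m+k}\operatorname{M}(q^2,q)^T\Big], \] where $\operatorname{M}(q,q)$ and $\operatorname{M}(q^2,q)=\Big[q^{m+i-j}\begin{bmatrix}\lambda_i-1+m+i-j\\ m+i-j\end{bmatrix}_{q^2}\Big]$ are specializations of $\operatorname{M}(q,t)$.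
   Context: $[n]_q=\frac{1-q^n}{1-q}$, $[n]_q!=\prod_{i=1}^n[i]_q$, and $\begin{bmatrix}n\\k\end{bmatrix}_q=\frac{[n]_q!}{[k]_q![n-k]_q!}$ if $0\le k\le n$ and $0$ otherwise. A shifted plane partition of shifted shape $\lambda$ is an array of nonnegative integers $\pi=(\pi_{i,j})_{1\le i\le k,\ i\le j\le \lambda_i+i-1}$ with $\pi_{i,j}\ge\pi_{i+1,j}$ and $\pi_{i,j}\ge\pi_{i,j+1}$ whenever both are defined; $\mathit{SPP}(m;\lambda)$ is the set of those with all entries at most $m$. Its $(q,t)$-generating function is $|\mathit{SPP}(m;\lambda;q,t)|=\sum_{\pi\in\mathit{SPP}(m;\lambda)}q^{\sum_{i<j}\pi_{i,j}}t^{\sum_i\pi_{i,i}}$ and its volume generating function is $|\mathit{SPP}(m;\lambda;q)|=\sum_{\pi}q^{\sum_{i\le j}\pi_{i,j}}$. $\overline{\lambda}$ is the symmetric partition whose $i$-th row has $\lambda_i+i-1$ boxes for $1\le i\le k$ and whose Durfee square has size $k$. For a symmetric partition $\mu$, $\mathit{PP}_{sym}(m;\mu)$ is the set of plane partitions $\pi=(\pi_{i,j})$ of shape $\mu$ (nonnegative integers on the boxes of the Young diagram of $\mu$, weakly decreasing along rows and columns) with $\pi_{i,j}=\pi_{j,i}$ and all entries at most $m$; $|\mathit{PP}_{sym}(m;\mu;q)|=\sum_{\pi}q^{\sum_{i,j}\pi_{i,j}}$. *)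

(* Defs.v *)
From HB Require Import structures.
From mathcomp Require Import all_boot all_order all_algebra.
From mathcomp Require Import zify.

Set Implicit Arguments.
Unset Strict Implicit.
Unset Printing Implicit Defensive.

Import GRing.Theory.

(* Rows, columns and parts are indexed from 0 throughout, so that part i of a
   partition s (0 if there is none) is [nth 0 s i]. *)

Definition strict_partition (lam : seq nat) : bool :=
  sorted gtn lam && all (ltn 0) lam.

Definition int_partition (mu : seq nat) : bool :=
  sorted geq mu && all (ltn 0) mu.

Definition shifted_diagram (lam : seq nat) : seq (nat * nat) :=
  [seq (i, j) | i <- iota 0 (size lam), j <- iota i (nth 0 lam i)].

Definition young_diagram (mu : seq nat) : seq (nat * nat) :=
  [seq (i, j) | i <- iota 0 (size mu), j <- iota 0 (nth 0 mu i)].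

Definition filling (D : seq (nat * nat)) (m : nat) : finType :=
  {ffun seq_sub D -> 'I_m.+1}.

Definition weakly_decreasing (D : seq (nat * nat)) (m : nat)
    (p : filling D m) : bool :=
  [forall b, forall c,
     ((val c == ((val b).1.+1, (val b).2)) ||
      (val c == ((val b).1, (val b).2.+1))) ==> (p c <= p b)].

Definition SPP (m : nat) (lam : seq nat) :
    {set filling (shifted_diagram lam) m} :=
  [set p | weakly_decreasing p].

Definition PPsym (m : nat) (mu : seq nat) :
    {set filling (young_diagram mu) m} :=
  [set p | weakly_decreasing p &
     [forall b, forall c,
        (val c == ((val b).2, (val b).1)) ==> (p b == p c)]].

Definition volume (D : seq (nat * nat)) (m : nat) (p : filling D m) : nat :=
  \sum_b p b.

Definition diag_volume (D : seq (nat * nat)) (m : nat) (p : filling D m) : nat :=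
  \sum_(b | (val b).1 == (val b).2) p b.

Definition upper_volume (D : seq (nat * nat)) (m : nat) (p : filling D m) : nat :=
  \sum_(b | (val b).1 < (val b).2) p b.

Definition symmetric_partition (mu : seq nat) : Prop :=
  int_partition mu /\
  forall i j, ((i, j) \in young_diagram mu) = ((j, i) \in young_diagram mu).

Definition durfee (mu : seq nat) : nat :=
  \max_(d < (size mu).+1 |
        all (mem (young_diagram mu))
            [seq (i, j) | i <- iota 0 d, j <- iota 0 d]) d.

Definition is_doubling (lam mu : seq nat) : Prop :=
  [/\ symmetric_partition mu,
      forall i, i < size lam -> nth 0 mu i = nth 0 lam i + i
    & durfee mu = size lam].

(* The symmetric partition written as lambda with a bar; [doublingP] below
   shows that it is the only partition satisfying [is_doubling]. *)
Definition doubling (lam : seq nat) : seq nat :=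
  mkseq (fun i => if i < size lam then nth 0 lam i + i
                  else count (fun j => i < nth 0 lam j + j)
                             (iota 0 (size lam)))
        (head 0 lam).

Lemma mem_young (mu : seq nat) i j :
  ((i, j) \in young_diagram mu) = (j < nth 0 mu i).
Proof.
apply/allpairsPdep/idP => [[a [b [ain bin [-> ->]]]]|lt_j].
  by move: bin; rewrite mem_iota.
exists i, j; split=> //; last by rewrite mem_iota.
rewrite mem_iota /=; case: (ltnP i (size mu)) => // le_i.
by rewrite nth_default in lt_j.
Qed.

Lemma mem_shifted (lam : seq nat) i j :
  ((i, j) \in shifted_diagram lam) = (i <= j < nth 0 lam i + i).
Proof.
apply/allpairsPdep/idP => [[a [b [ain bin [-> ->]]]]|lt_j].
  by move: bin; rewrite mem_iota addnC.
exists i, j; split=> //; last by rewrite mem_iota addnC.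
rewrite mem_iota /=; case: (ltnP i (size lam)) => // le_i.
by rewrite nth_default in lt_j; lia.
Qed.

Lemma partition_nth (mu : seq nat) :
  int_partition mu -> forall i j, i <= j -> nth 0 mu j <= nth 0 mu i.
Proof.
case/andP=> smu _ i j le_ij; case: (ltnP j (size mu)) => [ltj|gej].
  have := sorted_leq_nth (rev_trans leq_trans) leqnn 0 smu i j.
  by rewrite !inE; apply=> //; apply: leq_ltn_trans ltj.
by rewrite [nth 0 mu j]nth_default.
Qed.

Lemma durfee_square (mu : seq nat) (d : nat) : int_partition mu ->
  all (mem (young_diagram mu)) [seq (i, j) | i <- iota 0 d, j <- iota 0 d]
  = (d == 0) || (d <= nth 0 mu d.-1).
Proof.
move=> pmu; apply/allP/idP => [H|led x].
  case: d H => [//|d] H /=; rewrite -mem_young; apply: H.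
  by apply/allpairsPdep; exists d, d; rewrite !mem_iota; split=> //; lia.
case/allpairsPdep=> a [b [ain bin ->]]; rewrite [mem _ _]mem_young.
move: ain bin; rewrite !mem_iota => ain bin.
have : nth 0 mu d.-1 <= nth 0 mu a by apply: partition_nth => //; lia.
by lia.
Qed.

Lemma durfeeP (mu : seq nat) (k : nat) : int_partition mu ->
  (durfee mu = k <->
   ((k == 0) || (k <= nth 0 mu k.-1)) /\ nth 0 mu k <= k).
Proof.
move=> pmu.
have dE : durfee mu
    = \max_(d < (size mu).+1 | (val d == 0) || (d <= nth 0 mu (val d).-1)) d.
  by apply: eq_bigl => d; rewrite durfee_square.
have ex0 : (0 == 0) || (0 <= nth 0 mu 0.-1) by [].
have in_sz d : (d == 0) || (d <= nth 0 mu d.-1) -> d < (size mu).+1.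
  case: d => // d /= H; case: (ltnP d (size mu)) => // ge.
  by rewrite nth_default in H.
have sat : (durfee mu == 0) || (durfee mu <= nth 0 mu (durfee mu).-1).
  rewrite dE.
  have /= [|d dP ->] := @eq_bigmax_cond _
      (fun d : 'I_(size mu).+1 => (val d == 0) || (d <= nth 0 mu (val d).-1))
      val; last by [].
  by apply/card_gt0P; exists ord0.
have ub d : (d == 0) || (d <= nth 0 mu d.-1) -> d <= durfee mu.
  move=> H; rewrite dE.
  exact: (@leq_bigmax_cond _
    (fun d : 'I_(size mu).+1 => (val d == 0) || (d <= nth 0 mu (val d).-1))
    val (Ordinal (in_sz _ H))).
split=> [<-|[H1 H2]].
  split=> //; rewrite leqNgt; apply/negP => H.
  by have := ub (durfee mu).+1; rewrite /= H; lia.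
apply/eqP; rewrite eqn_leq ub // andbT leqNgt; apply/negP => lt.
case/orP: sat => [/eqP|] H; first by lia.
have : nth 0 mu (durfee mu).-1 <= nth 0 mu k by apply: partition_nth => //; lia.
by lia.
Qed.

Lemma doubling_uniq (lam mu mu' : seq nat) :
  is_doubling lam mu -> is_doubling lam mu' -> mu = mu'.
Proof.
have key nu i j : is_doubling lam nu ->
    (j < nth 0 nu i) = if i < size lam then j < nth 0 lam i + i
      else (j < size lam) && (i < nth 0 lam j + j).
  move=> [[pnu sym] rows /(durfeeP _ pnu)[_ dk]].
  case: (ltnP i (size lam)) => [/rows -> //|ge_i].
  case: (ltnP j (size lam)) => [lt_j|ge_j] /=.
    by rewrite -mem_young sym mem_young rows.
  apply/negbTE; rewrite -leqNgt.
  by have := partition_nth pnu ge_i; lia.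
move=> H H'.
have nthE i : nth 0 mu i = nth 0 mu' i.
  have E j : (j < nth 0 mu i) = (j < nth 0 mu' i) by rewrite !(key _ _ _ H, key _ _ _ H').
  by have := E (nth 0 mu i); have := E (nth 0 mu' i); lia.
case: H => [[/andP[_ pos] _] _ _]; case: H' => [[/andP[_ pos'] _] _ _].
have szE : size mu = size mu'.
  case: (ltngtP (size mu) (size mu')) => // lt.
    by have /(allP pos') := mem_nth 0 lt; rewrite -nthE nth_default.
  by have /(allP pos) := mem_nth 0 lt; rewrite nthE nth_default.
exact: (eq_from_nth szE).
Qed.

Lemma strict_nth (lam : seq nat) : strict_partition lam ->
  forall i j, i <= j < size lam -> nth 0 lam j + j <= nth 0 lam i + i.
Proof.
case/andP=> slam _ i j /andP[le_ij]; rewrite -(subnKC le_ij).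
elim: (j - i) => [|d IH]; first by rewrite addn0.
rewrite addnS => lt; have := IH (ltnW lt).
by have /= := (sortedP 0) slam (i + d) lt; lia.
Qed.

Lemma is_doubling_doubling (lam : seq nat) :
  strict_partition lam -> is_doubling lam (doubling lam).
Proof.
move=> slam; have sn := strict_nth slam; set k := size lam.
have posl i : i < k -> 0 < nth 0 lam i.
  by move=> lt; case/andP: slam => _ /allP; apply; apply: mem_nth.
have ge_k i : i < k -> k <= nth 0 lam i + i.
  move=> lt; have := sn i k.-1; have := posl k.-1; rewrite -/k; lia.
have hd : head 0 lam = nth 0 lam 0 by rewrite nth0.
pose P i j := i < nth 0 lam j + j.
have cntP i n j : n <= k ->
    (j < count (P i) (iota 0 n)) = (j < n) && P i j.
  elim: n => [|n IH] // lt.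
  have -> : iota 0 n.+1 = iota 0 n ++ [:: n] by rewrite -addn1 iotaD.
  rewrite count_cat /= addn0.
  have {}IH := IH (ltnW lt).
  case Pn: (P i n).
    have -> : count (P i) (iota 0 n) = n.
      rewrite -[RHS](size_iota 0 n); apply/eqP; rewrite -all_count.
      apply/allP=> l; rewrite mem_iota /P => ll.
      by have := sn l n; rewrite -/k; move: Pn; rewrite /P; lia.
    rewrite addn1; case: ltnP => //= le_jn.
    by have := sn j n; rewrite -/k; move: Pn; rewrite /P; lia.
  by rewrite addn0 IH ltnS; case: ltngtP => // ->; rewrite Pn.
have nthE i j : (j < nth 0 (doubling lam) i) =
    if i < k then j < nth 0 lam i + i else (j < k) && P i j.
  case: (ltnP i (head 0 lam)) => [lti|gei].
    by rewrite nth_mkseq // -/k; case: ifP => // _; rewrite cntP.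
  rewrite nth_default ?size_mkseq // ltn0; case: ltnP => [ltk|gek].
    by have := ge_k 0; have := sn 0 i; have := posl i; rewrite -/k; lia.
  case: ltnP => //= ltj; have := sn 0 j; rewrite -/k /P; lia.
have pd : int_partition (doubling lam).
  apply/andP; split.
    apply/(sortedP 0) => i _ /=; rewrite leqNgt.
    apply/negP; rewrite nthE => H.
    have : ~~ (nth 0 (doubling lam) i < nth 0 (doubling lam) i) by rewrite ltnn.
    move: H; rewrite nthE /P; set x := nth 0 (doubling lam) i.
    have := sn i i.+1; have := ge_k i; have := sn x x; rewrite -/k.
    by case: (ltnP i k); case: (ltnP i.+1 k); lia.
  apply/(all_nthP 0) => i; rewrite size_mkseq => lti /=; rewrite nthE /P.
  have k0 : 0 < k by rewrite /k; case: (lam) lti.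
  by have := posl i; have := sn 0 i; case: (ltnP i k); rewrite -/k; lia.
split=> [|i lti|].
- split=> // i j; rewrite !mem_young !nthE /P.
  by have := ge_k i; have := ge_k j; case: (ltnP i k); case: (ltnP j k); lia.
- have := nthE i (nth 0 (doubling lam) i); have := nthE i (nth 0 lam i + i).
  by rewrite -/k in lti; rewrite lti; lia.
- apply/(durfeeP _ pd); split; last first.
    by rewrite leqNgt nthE -/k !ltnn.
  rewrite -/k; have [//|k0 /=] := eqVneq k 0.
  have lt_k : k.-1 < k by lia.
  have := nthE k.-1 k.-1; rewrite lt_k.
  by have := ge_k k.-1 lt_k; have := posl k.-1 lt_k; lia.
Qed.

Lemma doublingP (lam mu : seq nat) : strict_partition lam ->
  is_doubling lam mu <-> mu = doubling lam.
Proof.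
move=> /is_doubling_doubling H; split=> [H'|-> //].
exact: doubling_uniq H' H.
Qed.

Local Open Scope ring_scope.

Section GeneratingFunctions.
Variable R : nzSemiRingType.

Definition SPP_gf2 (m : nat) (lam : seq nat) (q t : R) : R :=
  \sum_(p in SPP m lam) q ^+ upper_volume p * t ^+ diag_volume p.

Definition SPP_gf (m : nat) (lam : seq nat) (q : R) : R :=
  \sum_(p in SPP m lam) q ^+ volume p.

Definition PPsym_gf (m : nat) (mu : seq nat) (q : R) : R :=
  \sum_(p in PPsym m mu) q ^+ volume p.

End GeneratingFunctions.

Section QAnalogues.
Variable F : fieldType.

Definition qint (q : F) (n : nat) : F := (1 - q ^+ n) / (1 - q).

Definition qfact (q : F) (n : nat) : F := \prod_(1 <= i < n.+1) qint q i.

Definition qbinom (q : F) (n k : int) : F :=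
  if 0 <= k <= n then qfact q `|n| / (qfact q `|k| * qfact q `|n - k|) else 0.

(* The exponent m + i - j is unaffected by indexing from 0 rather than 1. *)
Definition Mmat (m : nat) (lam : seq nat) (q t : F) :
    'M[F]_(size lam, m + size lam) :=
  \matrix_(i, j)
    let d : int := m%:Z + i%:Z - j%:Z in
    t ^ d * qbinom q ((nth 0%N lam i)%:Z - 1 + d) d.

Definition Umat (n : nat) : 'M[F]_n :=
  \matrix_(i, j) if (i < j)%N then 2 else if i == j then 1 else 0.

End QAnalogues.

(* The field of rational functions in two indeterminates q (inner) and t (outer). *)
Definition Qqt : fieldType := {fraction {poly {poly int}}}.

Definition q_ : Qqt := tofrac ('X%:P).

Definition t_ : Qqt := tofrac 'X.

(* Main.v *)
(** Reading a shifted plane partition along its diagonals gives a chain of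
    interlacing sequences. Summing a determinant over the sequences interlacing
    a given one is again a determinant (columns telescope), so the fillings with
    prescribed main diagonal are counted by a maximal minor of [Mmat], and
    [SPP_gf2] is the sum of all its maximal minors.

    The square of the sum F(M) of the maximal minors is det (M U M^T). With r
    the first row of M, s_i the others and B(x, y) = x U y^T, one has
      F(r, s) = (-1)^k (sum of r) F(s) + sum_i (-1)^i B(r, s_i) F(s without s_i),
    so if r is made orthogonal to all s_i by row operations, both F^2 and the
    determinant pick up the factor B(r, r) = (sum of r)^2, and induction on the
    number of rows applies. Over a polynomial ring the sum of r can be assumed
    nonzero. *)

Require Import Defs.
From HB Require Import structures.
From mathcomp Require Import all_boot all_order all_algebra.
From mathcomp Require Import zify ring.

Set Implicit Arguments.
Unset Strict Implicit.
Unset Printing Implicit Defensive.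

Import GRing.Theory.
Local Open Scope ring_scope.

(** * Alternating forms summed over subsequences *)

Section AlternatingForms.
Variables (R : comNzRingType) (V : lmodType R).
Implicit Types (D : seq V -> R) (cs xs pre post : seq V) (x y c : V).

Fixpoint subsum cs D : R :=
  if cs is c :: cs' then subsum cs' D + subsum cs' (fun xs => D (c :: xs))
  else D [::].

(** A form takes lists of any length and vanishes off length k. Contraction with c is then just
    [D (c :: xs)], and [subsum], which runs over subsequences of all lengths, only sees those with k
    entries. *)
Definition altform (k : nat) D : Prop :=
  [/\ forall xs, size xs != k -> D xs = 0,
      forall pre post a x y, D (pre ++ (a *: x + y) :: post)
        = a * D (pre ++ x :: post) + D (pre ++ y :: post)
    & forall pre post x, D (pre ++ x :: x :: post) = 0].

(* Exterior product of the functional r with D, as an antiderivation. *)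
Fixpoint wedge (r : V -> R) D xs : R :=
  if xs is x :: xs' then r x * D xs' - wedge r (fun ys => D (x :: ys)) xs'
  else 0.

(* sum_(a <= b) (r c_a) U_(a, b) c_b *)
Fixpoint triangular_sum (r : V -> R) cs : V :=
  if cs is c :: cs' then
    r c *: (c + (\sum_(b <- cs') b) *+ 2) + triangular_sum r cs'
  else 0.

Lemma eq_subsum cs D D' : D =1 D' -> subsum cs D = subsum cs D'.
Proof.
elim: cs D D' => [|c cs IH] D D' eqD /=; first exact: eqD.
by congr (_ + _); apply: IH => // xs; apply: eqD.
Qed.

Lemma subsumP cs D D' a :
  subsum cs (fun xs => a * D xs + D' xs) = a * subsum cs D + subsum cs D'.
Proof.
elim: cs D D' => [|c cs IH] D D' //=.
by rewrite IH (IH (fun xs => D (c :: xs))); ring.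
Qed.

Lemma subsumZ cs D a : subsum cs (fun xs => a * D xs) = a * subsum cs D.
Proof.
elim: cs D => [|c cs IH] D //=.
by rewrite IH (IH (fun xs => D (c :: xs))); ring.
Qed.

Lemma altform0 k D : (forall xs, D xs = 0) -> altform k D.
Proof. by move=> D0; split=> *; rewrite !D0 ?mulr0 ?addr0. Qed.

(* Contracting a form of degree 0 gives 0, to which any degree can be assigned. *)
Lemma altform_contract k D c : altform k D ->
  exists2 k', altform k' (fun xs => D (c :: xs)) & odd k' = ~~ odd k.
Proof.
case: k => [|k] [szD linD altD].
  by exists 1%N => //; apply: altform0 => xs; apply: szD.
exists k; last by rewrite /= negbK.
split=> [xs szx|pre post a x y|pre post x].
- by apply: szD.
- exact: (linD (c :: pre)).
- exact: (altD (c :: pre)).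
Qed.

Section Degree.
Variables (k : nat) (D : seq V -> R).
Hypothesis aD : altform k D.

Lemma altP a x y post :
  D ((a *: x + y) :: post) = a * D (x :: post) + D (y :: post).
Proof. by case: aD => _ linD _; apply: (linD [::]). Qed.

Lemma altD x y post : D ((x + y) :: post) = D (x :: post) + D (y :: post).
Proof. by rewrite -[x]scale1r altP !scale1r mul1r. Qed.

Lemma alt0 post : D (0 :: post) = 0.
Proof. by have /eqP := altD 0 0 post; rewrite addr0 eq_sym -subr_eq0 addrK => /eqP. Qed.

Lemma altZ a x post : D ((a *: x) :: post) = a * D (x :: post).
Proof. by rewrite -[a *: x]addr0 altP alt0 addr0. Qed.

Lemma alt_sum I (s : seq I) (f : I -> V) post :
  D ((\sum_(i <- s) f i) :: post) = \sum_(i <- s) D (f i :: post).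
Proof.
by elim: s => [|i s IH]; rewrite ?big_nil ?alt0 // !big_cons altD IH.
Qed.

Lemma altxx x post : D (x :: x :: post) = 0.
Proof. by case: aD => _ _ altD; apply: (altD [::]). Qed.

Lemma altC x y post : D (x :: y :: post) = - D (y :: x :: post).
Proof.
case: aD => szD linD altD'.
have lin2 u v w : D (w :: (u + v) :: post) = D (w :: u :: post) + D (w :: v :: post).
  by have := linD [:: w] post 1 u v; rewrite scale1r mul1r.
have := altxx (x + y) post.
by rewrite altD !lin2 !altxx add0r addr0 => /eqP; rewrite addr_eq0 => /eqP.
Qed.

End Degree.

Lemma subsum0 cs D : (forall xs, D xs = 0) -> subsum cs D = 0.
Proof. by elim: cs D => [|c cs IH] D D0 //=; rewrite !IH ?addr0. Qed.

(** Expand the sum. A k-element subsequence arises from each of its k elements pulled to the front,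
    with alternating signs starting at +1; these add up to 1 for odd k and to 0 for even k. *)
Lemma subsum_contract_sum k cs D : altform k D ->
  subsum cs (fun xs => D ((\sum_(b <- cs) b) :: xs)) = (odd k)%:R * subsum cs D.
Proof.
elim: cs k D => [|c cs IH] k D aD; rewrite /= ?big_nil ?big_cons.
  rewrite (alt0 aD); case: k aD => [|k] aD; first by rewrite mul0r.
  by case: aD => -> //; rewrite mulr0.
set S := \sum_(b <- cs) b.
have [k' aDc oddk'] := altform_contract c aD.
rewrite (@eq_subsum _ (fun xs => D ((c + S) :: xs))
           (fun xs => 1 * D (c :: xs) + D (S :: xs)));
  last by move=> xs; rewrite (altD aD) mul1r.
rewrite (@eq_subsum _ (fun xs => D ((c + S) :: c :: xs))
   (fun xs => -1 * D (c :: S :: xs)));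
  last by move=> xs; rewrite (altD aD) (altxx aD) add0r (altC aD) mulN1r.
rewrite subsumP subsumZ (IH _ _ aD) (IH _ _ aDc) oddk'.
by case: (odd k) => /=; ring.
Qed.

(** Compare the coefficients of r(c) D(xs), telling elements apart by position. If c is not in xs
    and p of the k entries of xs precede it, the right side has (-1)^k + 2 sum_(p <= i < k) (-1)^i =
    (-1)^p, the sign in the wedge. If c is the entry in place p, it has (-1)^k + (-1)^p + 2 sum_(p <
    i < k) (-1)^i = 0. The proof adds the elements of [cs] one at a time. *)
Lemma subsum_wedge r k cs D : altform k D ->
  subsum cs (wedge r D) =
    (-1) ^+ k * (\sum_(c <- cs) r c) * subsum cs D
    + subsum cs (fun xs => D (triangular_sum r cs :: xs)).
Proof.
elim: cs k D => [|c cs IH] k D aD /=.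
  by rewrite big_nil (alt0 aD) mulr0 mul0r addr0.
set S := \sum_(b <- cs) b; set W := triangular_sum r cs.
have [k' aDc oddk'] := altform_contract c aD.
have W' xs : D ((r c *: (c + S *+ 2) + W) :: xs)
    = r c * (2 * D (S :: xs) + D (c :: xs)) + D (W :: xs).
  by rewrite (altP aD) (altD aD) -scaler_nat (altZ aD) [D (c :: xs) + _]addrC.
rewrite (eq_subsum _ W') (eq_subsum _ (fun xs => W' (c :: xs))).
rewrite !(subsumP _ _ (fun xs => D (W :: _))) !subsumP.
rewrite (@eq_subsum _ (fun xs => - wedge _ _ xs)
           (fun xs => -1 * wedge r (fun ys => D (c :: ys)) xs));
  last by move=> xs; rewrite mulN1r.
rewrite (@eq_subsum _ (fun xs => D (c :: c :: xs)) (fun=> 0));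
  last by move=> xs; rewrite (altxx aD).
rewrite (@eq_subsum _ (fun xs => D (W :: c :: xs)) (fun xs => -1 * D (c :: W :: xs)));
  last by move=> xs; rewrite (altC aD) mulN1r.
rewrite (@eq_subsum _ (fun xs => D (S :: c :: xs)) (fun xs => -1 * D (c :: S :: xs)));
  last by move=> xs; rewrite (altC aD) mulN1r.
rewrite !subsumZ (subsum0 _ (fun=> erefl)) (subsum_contract_sum _ aD).
rewrite (subsum_contract_sum _ aDc) big_cons (IH _ _ aD) (IH _ _ aDc) -/W.
(* The degree k' of the contraction is known only up to parity, so the signs are rewritten in terms
   of it. *)
rewrite -(signr_odd _ k') -(signr_odd _ k) oddk'.
by case: (odd k); rewrite /= ?expr1 ?expr0; ring.
Qed.

Lemma wedgeE r D xs : wedge r D xs =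
  \sum_(j < size xs) (-1) ^+ j * r (nth 0 xs j) * D (take j xs ++ drop j.+1 xs).
Proof.
elim: xs D => [|x xs IH] D /=; first by rewrite big_ord0.
rewrite big_ord_recl /= mul1r drop0 IH -sumrN; congr (_ + _).
by apply: eq_bigr => j _; rewrite /bump /= add1n exprS mulN1r !mulNr.
Qed.

Lemma triangular_sumE r cs : triangular_sum r cs =
  \sum_(a < size cs) r (nth 0 cs a) *:
    \sum_(b < size cs) (if (a < b)%N then 2 else if a == b :> nat then 1 else 0 : R)
                         *: nth 0 cs b.
Proof.
elim: cs => [|c cs IH] /=; first by rewrite big_ord0.
rewrite big_ord_recl /= big_ord_recl /= scale1r; congr (_ *: (_ + _) + _).
  by rewrite (big_nth 0) big_mkord -scaler_nat scaler_sumr.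
rewrite IH; apply: eq_bigr => a _; rewrite big_ord_recl /= scale0r add0r.
by congr (_ *: _); apply: eq_bigr => b _; rewrite /= ltnS.
Qed.

End AlternatingForms.

Lemma subsum_map (R : comNzRingType) (V W : lmodType R) (f : V -> W) cs D :
  subsum [seq f c | c <- cs] D = subsum cs (fun xs => D [seq f x | x <- xs]).
Proof. by elim: cs D => [|c cs IH] D //=; rewrite !IH. Qed.

(** * The sum of the maximal minors and its square *)

Section SumOfMinors.
Variable R : comNzRingType.

Definition rowsdet k (xs : seq 'rV[R]_k) : R :=
  if size xs == k then \det (\matrix_(j < k) nth 0 xs j) else 0.

Lemma altform_rowsdet k : altform k (@rowsdet k).
Proof.
split=> [xs /negbTE szx|pre post a x y|pre post x]; rewrite /rowsdet.
- by rewrite szx.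
- rewrite !size_cat /=; case: eqP => [szk|]; last by rewrite mulr0 addr0.
  have lt_pre : (size pre < k)%N.
    by apply: leq_trans (eq_leq szk); rewrite addnS ltnS leq_addr.
  have nthE z (j : 'I_k) : j != Ordinal lt_pre ->
      nth 0 (pre ++ z :: post) j = nth 0 (pre ++ 0 :: post) j :> 'rV[R]_k.
    rewrite -val_eqE /= !nth_cat; case: ltngtP => // gt _.
    by case E: (j - size pre)%N => [|d] //; move: gt; rewrite -subn_gt0 E.
  rewrite -[\det (\matrix_j nth 0 (pre ++ y :: post) j)]mul1r.
  apply: (determinant_multilinear (i0 := Ordinal lt_pre)).
  + by rewrite !rowK !nth_cat ltnn subnn /= scale1r.
  + apply/row_matrixP => j; rewrite !row_rowsub !rowK.
    by rewrite !(nthE _ (lift _ _)) // eq_sym neq_lift.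
  + apply/row_matrixP => j; rewrite !row_rowsub !rowK.
    by rewrite !(nthE _ (lift _ _)) // eq_sym neq_lift.
- rewrite size_cat /=; case: eqP => // szk.
  have lt1 : (size pre < k)%N.
    by apply: leq_trans (eq_leq szk); rewrite addnS ltnS leq_addr.
  have lt2 : ((size pre).+1 < k)%N.
    by apply: leq_trans (eq_leq szk); rewrite !addnS !ltnS leq_addr.
  apply: (determinant_alternate (i1 := Ordinal lt1) (i2 := Ordinal lt2)).
    by rewrite -val_eqE /= neq_ltn ltnSn.
  by move=> j; rewrite !mxE /= !nth_cat ltnn subnn ltnNge leqnSn subSnn.
Qed.

(* Sum of the maximal minors of M. *)
Definition minorsum k n (M : 'M[R]_(k, n)) : R :=
  subsum [seq row j M^T | j <- enum 'I_n] (@rowsdet k).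

(** Laplace expansion along the column of first coordinates. As the vectors will be the columns of
    M, the functional reads off the first row of M and [rsubmx] the remaining rows. *)
Lemma rowsdet_wedge k (xs : seq 'rV[R]_(1 + k)) :
  rowsdet xs = wedge (fun x : 'rV[R]_(1 + k) => x 0 0)
                 (fun ys : seq 'rV[R]_(1 + k) => rowsdet [seq rsubmx y | y <- ys]) xs.
Proof.
rewrite wedgeE /rowsdet /=.
case: eqP => [szx|szx]; last first.
  (* Deleting one entry from a list of length other than 1 + k leaves a length other than k, so
     every term is 0. *)
  symmetry; apply: big1 => j _; rewrite size_map size_cat size_take size_drop.
  by rewrite ltn_ord; case: eqP => [|_]; rewrite ?mulr0 //; have := ltn_ord j; lia.
rewrite (expand_det_col _ 0) szx; apply: eq_bigr => j _.
rewrite !mxE /cofactor addn0 mulrCA -mulrA; congr (_ * (_ * _)).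
have lt_j : (j < size xs)%N by rewrite szx.
rewrite size_map size_cat size_take size_drop lt_j szx.
have -> : ((j + (1 + k - j.+1))%N == k) by have := ltn_ord j; lia.
congr (\det _); apply/matrixP => a b; rewrite !mxE.
have lt_a : (a < size (take j xs ++ drop j.+1 xs))%N.
  rewrite size_cat size_take size_drop lt_j szx.
  by have := ltn_ord a; have := ltn_ord j; lia.
rewrite (nth_map 0) // !mxE nth_cat size_take lt_j /=.
rewrite (_ : rshift 1 b = lift 0 b); last exact: val_inj.
congr (fun_of_matrix _ _ _); rewrite /bump.
case: ltnP => [lt|ge]; first by rewrite nth_take.
by rewrite nth_drop; congr (nth _ _ _); lia.
Qed.

(** The matrix of [Umat], here over any commutative ring because the proof of [minorsum_sqr] passes
    to polynomials. *)
Definition trimx n : 'M[R]_n :=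
  \matrix_(i, j) if (i < j)%N then 2 else if i == j then 1 else 0.

Lemma nth_cols k n (M : 'M[R]_(k, n)) (j : 'I_n) :
  nth 0 [seq row i M^T | i <- enum 'I_n] j = row j M^T.
Proof. by rewrite (nth_map j) ?size_enum_ord // nth_ord_enum. Qed.

(** Coordinate i of this vector is B(r, row i), with r the first row, so the error term of
    [subsum_wedge] is governed by orthogonality to r. *)
Lemma triangular_sum_cols k n (M : 'M[R]_(1 + k, n)) :
  triangular_sum (fun x : 'rV[R]_(1 + k) => x 0 0) [seq row j M^T | j <- enum 'I_n]
  = row 0 M *m trimx n *m M^T.
Proof.
rewrite triangular_sumE /= size_map size_enum_ord.
apply/rowP => i; rewrite -mulmxA !mxE summxE; apply: eq_bigr => a _.
rewrite nth_cols !mxE summxE; congr (_ * _); apply: eq_bigr => b _.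
by rewrite !mxE nth_cols !mxE.
Qed.

Lemma minorsum_col_mx k n (r : 'rV[R]_n) (s : 'M[R]_(k, n)) :
  r *m trimx n *m s^T = 0 ->
  minorsum (col_mx r s) = (-1) ^+ k * (\sum_j r 0 j) * minorsum s.
Proof.
move=> rs0; rewrite /minorsum.
have col0 j : col_mx r s 0 j = r 0 j.
  by rewrite mxE; case: splitP => [i _|i] //; rewrite (ord1 i).
pose D (ys : seq 'rV[R]_(1 + k)) := rowsdet [seq rsubmx y | y <- ys].
rewrite (@eq_subsum _ _ _ _ (wedge (fun x : 'rV_(1 + k) => x 0 0) D));
  last exact: rowsdet_wedge.
have aD : altform k D.
  have [szD linD altD] := altform_rowsdet k.
  rewrite /D; split=> [xs szx|pre post a x y|pre post x].
  - by apply: szD; rewrite size_map.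
  - by rewrite !map_cat /= linearP linD.
  - by rewrite map_cat /= altD.
rewrite (subsum_wedge _ _ aD) triangular_sum_cols.
(* The form D sees only the coordinates after the first, and these are r U s^T = 0. *)
rewrite [X in _ + X]subsum0 ?addr0; last first.
  move=> xs; rewrite /D /=.
  have -> : rsubmx (row 0 (col_mx r s) *m trimx n *m (col_mx r s)^T) = 0 :> 'rV_k.
    rewrite tr_col_mx mul_mx_row row_mxKr (_ : row 0 _ = r) //; apply/rowP => j.
    by rewrite mxE col0.
  exact: (alt0 (altform_rowsdet k)).
congr (_ * _ * _).
  rewrite big_map big_enum; apply: eq_bigr => j _; by rewrite !mxE -col0 mxE.
rewrite /D -(subsum_map rsubmx) -map_comp; congr (subsum _ _).
apply: eq_map => j /=; rewrite tr_col_mx; apply/rowP => i.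
by rewrite !mxE (unsplitK (inr i)) !mxE.
Qed.

Lemma rowsdet_mul k (g : 'M[R]_k) (xs : seq 'rV[R]_k) :
  rowsdet [seq x *m g | x <- xs] = \det g * rowsdet xs.
Proof.
rewrite /rowsdet size_map; case: eqP => [szx|_]; last by rewrite mulr0.
rewrite mulrC -det_mulmx; congr (\det _); apply/row_matrixP => j.
by rewrite row_mul !rowK (nth_map 0) // szx.
Qed.

Lemma minorsum_mul k n (g : 'M[R]_k) (M : 'M[R]_(k, n)) :
  minorsum (g *m M) = \det g * minorsum M.
Proof.
rewrite -(det_tr g) /minorsum -subsumZ -(eq_subsum _ (rowsdet_mul g^T)).
rewrite -(subsum_map (mulmxr g^T)); congr (subsum _ _).
by rewrite -[RHS]map_comp; apply: eq_map => j /=; rewrite trmx_mul row_mul.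
Qed.

Lemma minorsum0 n (M : 'M[R]_(0, n)) : minorsum M = 1.
Proof.
rewrite /minorsum; elim: [seq _ | _ <- _] => [|c cs IH] /=.
  by rewrite /rowsdet /= det_mx00.
by rewrite IH subsum0 ?addr0.
Qed.

(** The entries of [trimx] in places (i, j) and (j, i) add up to 2, as they do in the all-ones
    matrix, and the diagonals are equal; so both matrices have the same quadratic form. *)
Lemma trimx_quadratic n (r : 'rV[R]_n) :
  r *m trimx n *m r^T = ((\sum_j r 0 j) ^+ 2)%:M.
Proof.
rewrite [LHS]mx11_scalar; congr (_%:M).
rewrite -mulmxA !mxE expr2 mulr_suml.
under eq_bigr => i _ do rewrite mxE mulr_sumr.
under [RHS]eq_bigr => i _ do rewrite mulr_sumr.
have E (f : 'I_n -> 'I_n -> R) :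
    \sum_i \sum_j f i j =
    \sum_i f i i + \sum_(i < n) \sum_(j < n | (i < j)%N) (f i j + f j i).
  have -> : \sum_i \sum_j f i j =
     \sum_(i < n) (f i i + (\sum_(j < n | (i < j)%N) f i j
                           + \sum_(j < n | (j < i)%N) f i j)).
    apply: eq_bigr => i _; rewrite (bigD1 i) //=; congr (_ + _).
    rewrite (bigID (fun j : 'I_n => (i < j)%N)) /=.
    by congr (_ + _); apply: eq_bigl => j; rewrite -val_eqE /=; case: ltngtP.
  rewrite !big_split /=; congr (_ + _); under [RHS]eq_bigr => i _ do rewrite big_split.
  rewrite big_split /=; congr (_ + _).
  by rewrite (exchange_big_dep xpredT).
rewrite !E; congr (_ + _); apply: eq_bigr => i _.
  by rewrite !mxE ltnn eqxx mul1r.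
apply: eq_bigr => j lt_ij; rewrite !mxE lt_ij ltnNge (ltnW lt_ij) /=.
by rewrite -val_eqE gtn_eqF //=; ring.
Qed.

End SumOfMinors.

Lemma minorsum_map (R S : comNzRingType) (f : {rmorphism R -> S})
    k n (M : 'M[R]_(k, n)) :
  minorsum (map_mx f M) = f (minorsum M).
Proof.
rewrite /minorsum; set cs := [seq row j M^T | j <- _].
have -> : [seq row j (map_mx f M)^T | j <- enum 'I_n] = [seq map_mx f c | c <- cs].
  by rewrite -[RHS]map_comp; apply: eq_map => j /=; rewrite map_row map_trmx.
have E xs : rowsdet [seq map_mx f x | x <- xs] = f (rowsdet xs) :> S.
  rewrite /rowsdet size_map; case: eqP => [szx|_]; last by rewrite rmorph0.
  rewrite -det_map_mx; congr (\det _); apply/row_matrixP => j.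
  by rewrite -map_row !rowK (nth_map 0) // szx.
have subsumE : forall (cs : seq 'rV[R]_k) (D : seq 'rV[S]_k -> S)
    (D' : seq 'rV[R]_k -> R), (forall xs, D [seq map_mx f x | x <- xs] = f (D' xs)) ->
    subsum [seq map_mx f x | x <- cs] D = f (subsum cs D') :> S.
  elim=> [|c l IH] D D' DE /=; first by rewrite -DE.
  by rewrite rmorphD /= (IH _ _ DE); congr (_ + _); apply: IH => xs; rewrite -DE.
exact: subsumE.
Qed.

Lemma trimx_map (R S : comNzRingType) (f : {rmorphism R -> S}) n :
  map_mx f (trimx R n) = trimx S n.
Proof.
apply/matrixP => i j; rewrite !mxE; case: ifP => _; first by rewrite rmorph_nat.
by case: ifP => _; rewrite ?rmorph1 ?rmorph0.
Qed.

(** Orthogonalizing s against r would divide by sg^2, with sg the sum of r. Instead s is first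
    multiplied by sg^2, which multiplies both sides by the square of (sg^2)^k; this is nonzero and
    is cancelled at the end. *)
Lemma minorsum_sqr_step (R : idomainType) k n (r : 'rV[R]_n) (s : 'M[R]_(k, n)) :
  \sum_j r 0 j != 0 ->
  (forall s' : 'M[R]_(k, n), minorsum s' ^+ 2 = \det (s' *m trimx R n *m s'^T)) ->
  minorsum (col_mx r s) ^+ 2
    = \det (col_mx r s *m trimx R n *m (col_mx r s)^T).
Proof.
set sg := \sum_j r 0 j; set U := trimx R n => sg0 IH.
pose b := r *m U *m s^T.
pose g : 'M[R]_(1 + k) := block_mx 1%:M 0 (- b^T) (sg ^+ 2)%:M.
pose s' := sg ^+ 2 *: s - b^T *m r.
have gM : g *m col_mx r s = col_mx r s'.
  by rewrite mul_block_col mul1mx mul0mx addr0 mul_scalar_mx addrC mulNmx.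
have detg : \det g = sg ^+ 2 ^+ k by rewrite det_lblock det1 mul1r det_scalar.
have rs'0 : r *m U *m s'^T = 0.
  rewrite linearB /= linearZ /= trmx_mul trmxK mulmxBr -scalemxAr mulmxA.
  by rewrite trimx_quadratic -/sg mul_scalar_mx subrr.
have det' : \det (col_mx r s' *m U *m (col_mx r s')^T)
    = sg ^+ 2 * \det (s' *m U *m s'^T).
  (* The form B is not symmetric, but one vanishing off-diagonal block makes the matrix block
     triangular. *)
  rewrite tr_col_mx mul_col_mx mul_col_row rs'0 trimx_quadratic det_lblock.
  by rewrite det_scalar1.
have detgM : \det (col_mx r s' *m U *m (col_mx r s')^T)
    = (sg ^+ 2 ^+ k) ^+ 2 * \det (col_mx r s *m U *m (col_mx r s)^T).
  by rewrite -gM trmx_mul !mulmxA !det_mulmx det_tr -detg -!mulmxA !det_mulmx; ring.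
have Fg : (sg ^+ 2 ^+ k * minorsum (col_mx r s)) ^+ 2 =
    sg ^+ 2 * minorsum s' ^+ 2.
  rewrite -detg -minorsum_mul gM minorsum_col_mx // -/sg !exprMn sqrr_sign.
  by rewrite mul1r.
apply: (@mulfI _ ((sg ^+ 2 ^+ k) ^+ 2)); first by rewrite !expf_neq0.
by rewrite -exprMn Fg -detgM det' IH.
Qed.

(* Adding 'X to one entry makes the sum of the first row nonzero. *)
Theorem minorsum_sqr (R : idomainType) k n (M : 'M[R]_(k, n)) :
  minorsum M ^+ 2 = \det (M *m trimx R n *m M^T).
Proof.
elim: k R M => [|k IH] R M; first by rewrite minorsum0 expr1n det_mx00.
case: n IH M => [|n] IH M.
  (* Without columns there is no entry to perturb; as M has at least one row, both sides are 0. *)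
  rewrite /minorsum (_ : enum 'I_0 = [::]) /=; last first.
    by apply/nilP; rewrite /nilp size_enum_ord.
  rewrite /rowsdet /= expr0n /= (_ : _ *m _ = 0) ?det0 //.
  by apply/matrixP => i j; rewrite !mxE big_ord0.
pose N : 'M[{poly R}]_(1 + k, n.+1) := map_mx polyC M + 'X *: delta_mx 0 0.
have MN : map_mx (horner_eval (0 : R)) N = M.
  by apply/matrixP => i j; rewrite !mxE /horner_eval !hornerE /=.
have := @minorsum_sqr_step _ _ _ (usubmx N) (dsubmx N).
rewrite vsubmxK => step.
have {}step : minorsum N ^+ 2 = \det (N *m trimx _ n.+1 *m N^T).
  (* The induction hypothesis is quantified over the ring, hence available over the polynomial
     ring. *)
  apply: step; last by move=> s'; apply: IH.
  have -> : \sum_j usubmx N 0 j = (\sum_j M 0 j)%:P + 'X.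
    rewrite rmorph_sum /= [in RHS](bigD1 ord0) //= (bigD1 ord0) //= addrAC.
    rewrite !mxE (_ : lshift k 0 = 0); last exact: val_inj.
    rewrite !eqxx mulr1; congr (_ + _); apply: eq_bigr => j j0.
    rewrite !mxE (_ : lshift k 0 = 0); last exact: val_inj.
    by rewrite (negbTE j0) andbF mulr0 addr0.
  by rewrite -size_poly_eq0 addrC size_XaddC.
(* Setting 'X to 0 recovers the identity for M. *)
rewrite -MN minorsum_map -rmorphXn /= step -det_map_mx !map_mxM map_trmx.
by rewrite trimx_map.
Qed.

(** * Homogeneous sums, interlacing and decreasing sequences *)

Section HomogeneousSums.
Variable R : comNzRingType.

(* The complete homogeneous symmetric polynomial of degree e in the n
   variables 1, q, ..., q^(n-1). *)
Fixpoint hsym (q : R) (n e : nat) : R :=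
  if n is n'.+1 then \sum_(e' < e.+1) q ^+ e' * hsym q n' e' else (e == 0%N)%:R.

(* The entry in place i has degree x + i - (k - 1), and is 0 if this is negative. *)
Definition jtrow k (a : nat -> nat -> R) (x : nat) : 'rV[R]_k :=
  \row_(i < k) if (k <= x + i.+1)%N then a i (x + i.+1 - k)%N else 0.

(** The total shift that makes a weakly decreasing sequence of length k strictly decreasing. *)
Definition staircase k : nat := \sum_(i < k) (k - i.+1).

(** The entry in row x and column i has degree x - (k - 1 - i), so its weight is a row factor t^x
    over a column factor t^(k-1-i). The column factors are kept on the left, which avoids dividing
    by t. *)
Lemma rowsdet_jtrow_weight k (t : R) a (xs : seq nat) :
  t ^+ staircase k * rowsdet [seq jtrow k (fun i e => t ^+ e * a i e) x | x <- xs]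
  = t ^+ sumn xs * rowsdet [seq jtrow k a x | x <- xs].
Proof.
rewrite /rowsdet !size_map; case: eqP => [szx|_]; last by rewrite !mulr0.
set A' := \matrix_j _; set A := \matrix_j _.
have E : A' *m diag_mx (\row_i t ^+ (k - i.+1)) = diag_mx (\row_j t ^+ nth 0%N xs j) *m A.
  apply/matrixP => j i; rewrite mul_mx_diag mul_diag_mx !mxE.
  rewrite !(nth_map 0%N) ?szx // !mxE; case: leqP => [le|_]; last by rewrite mul0r mulr0.
  by rewrite mulrAC -exprD; congr (_ ^+ _ * _); have := ltn_ord i; lia.
have := congr1 (@determinant R k) E; rewrite !det_mulmx !det_diag.
have prodE (f : 'I_k -> nat) : \prod_i (\row_i t ^+ f i) 0 i = t ^+ \sum_i f i.
  by under eq_bigr do rewrite mxE; rewrite prodrXr.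
rewrite !prodE mulrC => ->; congr (_ ^+ _ * _).
by rewrite sumnE (big_nth 0%N) szx big_mkord.
Qed.

(** The upper bounds are weak and the lower ones strict because both sequences carry the shift by k
    - 1 - i: without it the condition reads x_(i+1) <= y_i <= x_i. *)
Fixpoint interlacing (xs : seq nat) : seq (seq nat) :=
  if xs is x :: xs' then
    [seq y :: ys | y <- index_iota (if xs' is x' :: _ then x'.+1 else 0%N) x.+1,
                   ys <- interlacing xs']
  else [:: [::]].

(* Summing over each entry turns column j into P x_j - P x_(j+1), and the
   subtracted term is killed by the next column. *)
Lemma altform_interlacing (V : lmodType R) k (D : seq V -> R) (w : nat -> V) xs :
  altform k D -> sorted gtn xs ->
  \sum_(ys <- interlacing xs) D [seq w y | y <- ys]
  = D [seq \sum_(0 <= y < x.+1) w y | x <- xs].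
Proof.
elim: xs k D => [|x xs IH] k D aD sxs /=; first by rewrite big_seq1.
rewrite big_allpairs_dep /=.
under eq_bigr => y _.
  have [k' aDy _] := altform_contract (w y) aD.
  rewrite (IH _ _ aDy (path_sorted sxs)); over.
rewrite -(alt_sum aD) /=; case: xs sxs {IH} => [|x' xs] //= /andP[lt_x _].
rewrite [in RHS](@big_cat_nat _ _ _ x'.+1) //=; last by rewrite ltnS ltnW.
by rewrite [in RHS](altD aD) (altxx aD) add0r.
Qed.

(** As y grows by 1, so does the degree of every entry, and negative degrees contribute 0; hence
    each entry is summed over the degrees from 0 on. *)
Lemma sum_jtrow k a x :
  \sum_(0 <= y < x.+1) jtrow k a y
  = jtrow k (fun i e => \sum_(e' < e.+1) a i e') x.
Proof.
apply/rowP => i; rewrite summxE !mxE.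
under eq_bigr do rewrite mxE.
elim: x => [|x IH].
  rewrite big_nat1; case: leqP => // le.
  have -> : (0 + i.+1 - k = 0)%N by have := ltn_ord i; lia.
  by rewrite big_ord1.
rewrite big_nat_recr //= IH addSn.
case: (leqP k (x + i.+1)) => [le|lt].
  by rewrite (leq_trans le) // subSn // [in RHS]big_ord_recr.
rewrite add0r; case: leqP => // le.
(* Here the degree has just reached 0, so the sum has a single term. *)
have -> : ((x + i.+1).+1 - k = 0)%N by lia.
by rewrite big_ord1.
Qed.

Lemma mem_interlacing xs ys :
  reflect (size ys = size xs /\ forall i, (i < size xs)%N ->
             (nth 0 ys i <= nth 0 xs i)%N
             /\ ((i.+1 < size xs)%N -> (nth 0 xs i.+1 < nth 0 ys i)%N))
          (ys \in interlacing xs).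
Proof.
elim: xs ys => [|x xs IH] ys /=.
  by rewrite inE; apply: (iffP eqP) => [-> //|[/size0nil]].
apply: (iffP allpairsPdep) => [[y [zs [yin /IH[szz H] ->]]]|[szy H]].
  move: yin; rewrite mem_index_iota => yin; split=> [|[|i]] /=; first by rewrite szz.
    by case: xs {IH H szz} yin => [|x' xs] /=; lia.
  by rewrite !ltnS; apply: H.
case: ys szy H => [//|y ys] [szy] H; exists y, ys; split=> //.
  rewrite mem_index_iota; have := H 0%N (ltn0Sn _).
  by case: xs {IH szy H} => [|x' xs] /= [] ? H'; rewrite ?H' //; lia.
by apply/IH; split=> // i lt_i; have := H i.+1; rewrite /= !ltnS; apply.
Qed.

Lemma uniq_interlacing xs : uniq (interlacing xs).
Proof.
elim: xs => [|x xs IH] //=; apply: allpairs_uniq => //; first exact: iota_uniq.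
by move=> [y ys] [z zs] _ _ /= [-> ->].
Qed.

(** The recursion is that of [subsum] over n-1, ..., 0, which is the order in which the columns of
    [Mmat] will be read. *)
Fixpoint decreasing_seqs (n : nat) : seq (seq nat) :=
  if n is n'.+1 then decreasing_seqs n' ++ [seq n' :: s | s <- decreasing_seqs n']
  else [:: [::]].

Lemma mem_decreasing_seqs n s :
  (s \in decreasing_seqs n) = sorted gtn s && all (gtn n) s.
Proof.
elim: n s => [|n IH] s /=.
  by rewrite inE; case: s => [|x s] //=; rewrite andbF.
rewrite mem_cat IH; case: s => [|x s] //=.
have -> : ([:: x & s] \in [seq n :: s | s <- decreasing_seqs n])
    = (x == n) && (s \in decreasing_seqs n).
  apply/mapP/andP => [[s' s'in [-> ->]]|[/eqP -> sin]]; last by exists s.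
  by rewrite eqxx.
rewrite IH (path_sortedE (rev_trans ltn_trans)) /=.
have sub a b : (a <= b)%N -> all (gtn a) s -> all (gtn b) s.
  by move=> le_ab; apply: sub_all => z /= lt; apply: leq_trans le_ab.
apply/idP/idP => [/orP[/andP[-> /andP[lt_xn alls]]|/and3P[/eqP-> -> alls]]
                 |/andP[/andP[alls ss] /andP[le_xn _]]].
- by rewrite /= (sub n) // ltnS ltnW.
- by rewrite alls /= ltnSn (sub n).
rewrite alls ss /=; move: le_xn; rewrite ltnS leq_eqVlt => /orP[/eqP xn|lt_xn].
  by rewrite xn eqxx -xn alls orbT.
by rewrite lt_xn (sub x) // ltnW.
Qed.

Lemma uniq_decreasing_seqs n : uniq (decreasing_seqs n).
Proof.
elim: n => [|n IH] //=; rewrite cat_uniq IH map_inj_uniq ?IH ?andbT /=;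
  last by move=> ? ? [].
apply/hasPn => s /mapP[s' _ ->]; rewrite mem_decreasing_seqs /=.
by rewrite ltnn andbF.
Qed.

Lemma subsum_decreasing (V : lmodType R) (v : nat -> V) n (D : seq V -> R) :
  subsum [seq v x | x <- rev (iota 0 n)] D
  = \sum_(s <- decreasing_seqs n) D [seq v x | x <- s].
Proof.
elim: n D => [|n IH] D; first by rewrite big_seq1.
by rewrite -{1}[n.+1]addn1 iotaD rev_cat /= !IH big_cat big_map.
Qed.

End HomogeneousSums.

(** * Fillings as functions on all positions *)

Section Fillings.
Variables (D : seq (nat * nat)) (m : nat).
Implicit Types (p : filling D m) (f : nat * nat -> nat) (x : nat * nat).

(** With the value 0 outside the diagram, the inequalities between neighbours need no membership
    conditions, and fillings of different diagrams can be compared. *)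
Definition entry p x : nat := if insub x is Some b then p b else 0%N.

Definition mkfilling f : filling D m := [ffun b => inord (f (val b))].

Lemma entryE p (b : seq_sub D) : entry p (val b) = p b.
Proof. by rewrite /entry valK. Qed.

Lemma entry_out p x : x \notin D -> entry p x = 0%N.
Proof. by move=> xD; rewrite /entry insubN. Qed.

Lemma entry_le p x : (entry p x <= m)%N.
Proof. by rewrite /entry; case: insub => // b; rewrite -ltnS. Qed.

Lemma entry_mkfilling f x : (forall y, (f y <= m)%N) ->
  entry (mkfilling f) x = if x \in D then f x else 0%N.
Proof.
move=> f_le; rewrite /entry; case: insubP => [b -> <-|/negbTE -> //].
by rewrite ffunE inordK // ltnS.
Qed.

Lemma entry_inj p p' : {in D, entry p =1 entry p'} -> p = p'.
Proof.
by move=> E; apply/ffunP => b; apply: val_inj; have := E _ (valP b); rewrite !entryE.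
Qed.

Lemma sum_filling p (P : pred (nat * nat)) : uniq D ->
  (\sum_(b : seq_sub D | P (val b)) p b = \sum_(x <- D | P x) entry p x)%N.
Proof.
move=> uD; rewrite (eq_bigr (fun b => entry p (val b))) => [|b _];
  last by rewrite entryE.
rewrite -(big_map val P (entry p)); apply: perm_big.
apply: uniq_perm => //; first by rewrite (map_inj_uniq val_inj) index_enum_uniq.
move=> x; apply/mapP/idP => [[b _ ->]|xD]; first exact: valP.
by exists (SeqSub xD); rewrite // mem_index_enum.
Qed.

End Fillings.

(** * Shifted plane partitions and their main diagonal *)

Lemma uniq_shifted lam : uniq (shifted_diagram lam).
Proof.
apply: allpairs_uniq_dep => [|i _|]; try exact: iota_uniq.
by move=> [i j] [i' j'] _ _ /= [-> ->].
Qed.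

Lemma sorted_gtn_nth lam i : sorted gtn lam -> (i.+1 < size lam)%N ->
  (nth 0 lam i.+1 < nth 0 lam i)%N.
Proof. by move=> /(sortedP 0%N) H /H. Qed.

Section ShiftedPlanePartitions.
Variable m : nat.
Implicit Type lam : seq nat.

(** The hypothesis is [sorted gtn lam] so that the last part may be 0, as can happen after all parts
    have been lowered by one. *)
Lemma SPP_entryP lam (p : filling (shifted_diagram lam) m) : sorted gtn lam ->
  reflect (forall i j, (i <= j)%N ->
             (entry p (i, j.+1) <= entry p (i, j))%N
             /\ ((i < j)%N -> (entry p (i.+1, j) <= entry p (i, j))%N))
          (p \in SPP m lam).
Proof.
move=> slam; rewrite inE; apply: (iffP forallP) => [wp i j le_ij|H b].
  split=> [|lt_ij].
    case: (boolP ((i, j.+1) \in shifted_diagram lam)) => [inD|/entry_out -> //].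
    have inD' : (i, j) \in shifted_diagram lam by move: inD; rewrite !mem_shifted; lia.
    have /forallP/(_ (SeqSub inD)) := wp (SeqSub inD').
    by rewrite /= eqxx orbT /= -!entryE.
  case: (boolP ((i.+1, j) \in shifted_diagram lam)) => [inD|/entry_out -> //].
  have inD' : (i, j) \in shifted_diagram lam.
    (* Row i reaches at least as far right as row i + 1 because the parts strictly decrease. *)
    move: inD; rewrite !mem_shifted; case: (ltnP i.+1 (size lam)) => [lt|ge].
      by have := sorted_gtn_nth slam lt; lia.
    by rewrite nth_default //; lia.
  have /forallP/(_ (SeqSub inD)) := wp (SeqSub inD').
  by rewrite /= eqxx /= -!entryE.
apply/forallP => c; apply/implyP; rewrite -!entryE.
have := valP c; have := valP b; case: (val b) (val c) => i j [i' j'].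
rewrite !mem_shifted /= => bD cD /orP[] /eqP[? ?]; subst i' j'.
  by apply: (H i j _).2; lia.
by apply: (H i j _).1; lia.
Qed.

(* The shift by k - 1 - i makes the main diagonal strictly decreasing. *)
Definition shifted_diagonal (k : nat) D (p : filling D m) : seq nat :=
  mkseq (fun i => entry p (i, i) + (k - i.+1))%N k.

Lemma diag_volumeE lam (p : filling (shifted_diagram lam) m) :
  (diag_volume p + staircase (size lam)
   = sumn (shifted_diagonal (size lam) p))%N.
Proof.
rewrite sumnE /diag_volume (sum_filling p (fun x => x.1 == x.2)) ?uniq_shifted //.
have iotaE (f : nat -> nat) :
    (\sum_(i <- iota 0 (size lam)) f i = \sum_(i < size lam) f i)%N.
  by rewrite -{1}(subn0 (size lam)) big_mkord.
rewrite big_map big_split /= !iotaE; congr addn; rewrite -big_filter.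
(* A row whose part is 0 has no diagonal cell; [entry] is 0 there, so the row may stay in the sum on
   the right. *)
rewrite (perm_big [seq (i, i) | i <- iota 0 (size lam) & (0 < nth 0 lam i)%N]);
  last first.
  apply: uniq_perm; first by rewrite filter_uniq ?uniq_shifted.
    by rewrite map_inj_uniq ?filter_uniq ?iota_uniq // => ? ? [].
  move=> [i j]; rewrite mem_filter mem_shifted /=.
  apply/idP/mapP => [/andP[/eqP <- lti]|[i']].
    exists i => //; rewrite mem_filter mem_iota /=.
    case: (ltnP i (size lam)) => [|ge]; first by lia.
    by rewrite nth_default in lti; lia.
  by rewrite mem_filter => /andP[lt _] [-> ->]; rewrite eqxx /=; lia.
rewrite big_map big_filter big_mkcond /= iotaE; apply: eq_bigr => i _.
case: ltnP => // le0; rewrite entry_out // mem_shifted; lia.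
Qed.

Lemma volume_upper_diag lam (p : filling (shifted_diagram lam) m) :
  volume p = (upper_volume p + diag_volume p)%N.
Proof.
rewrite /volume (bigID (fun b => (val b).1 < (val b).2)%N); congr addn.
apply: eq_bigl => b; rewrite andTb; have := valP b; case: (val b) => i j.
by rewrite mem_shifted /=; lia.
Qed.

(** * Removing the main diagonal *)

Section PeelDiagonal.
Variables (lam xs : seq nat).
Let k := size lam.
Let lam' := map predn lam.
Hypotheses (slam : sorted gtn lam) (lam_gt0 : all (ltn 0) lam).
Hypotheses (sxs : sorted gtn xs) (szxs : size xs = k) (xs_lt : all (gtn (m + k)) xs).

Local Notation SF := (filling (shifted_diagram lam) m).
Local Notation SF' := (filling (shifted_diagram lam') m).

Let peel (p : SF) : SF' := mkfilling _ m (fun x => entry p (x.1, x.2.+1)).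
(** The minimum with m provides the bound that [entry_mkfilling] asks for at every position; on the
    diagonal cells it has no effect, by [xs_le]. *)
Let glue (p : SF') : SF := mkfilling _ m (fun x =>
  if x.1 == x.2 then minn m (nth 0%N xs x.1 - (k - x.1.+1)) else entry p (x.1, x.2.-1)).

Let lamE i : nth 0%N lam' i = (nth 0%N lam i).-1.
Proof.
rewrite /lam'; case: (ltnP i (size lam)) => [lt|ge]; first by rewrite (nth_map 0%N).
by rewrite !nth_default ?size_map.
Qed.

Let lam_pos i : (i < k)%N -> (0 < nth 0 lam i)%N.
Proof. by move=> lt; apply: (all_nthP 0%N lam_gt0). Qed.

Let lam_out i : (k <= i)%N -> nth 0%N lam i = 0%N.
Proof. by move=> ge; rewrite nth_default. Qed.

Let mem_shift i j :
  ((i, j) \in shifted_diagram lam') = (i <= j)%N && ((i, j.+1) \in shifted_diagram lam).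
Proof. by rewrite !mem_shifted lamE; lia. Qed.

(** This keeps the subtraction in [glue] from being truncated, so that adding the shift back
    restores [xs]. The induction counts from the last entry. *)
Let xs_ge i : (i < k)%N -> (k - i.+1 <= nth 0 xs i)%N.
Proof.
move=> lt_i; have E d : (d < k)%N -> (d <= nth 0 xs (k - d.+1))%N.
  elim: d => // d IH lt_d.
  have lt : ((k - d.+2).+1 < size xs)%N by rewrite szxs; lia.
  have := sorted_gtn_nth sxs lt; have := IH (ltnW lt_d).
  have -> : (k - d.+2).+1 = (k - d.+1)%N by lia.
  by lia.
have := E (k - i.+1)%N; have -> : (k - (k - i.+1).+1 = i)%N by lia.
by apply; lia.
Qed.

Let xs_le i : (i < k)%N -> (nth 0 xs i - (k - i.+1) <= m)%N.
Proof.
elim: i => [|i IH] lt_i.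
  have /= := all_nthP 0%N xs_lt 0%N; rewrite szxs => /(_ lt_i); lia.
have lt : (i.+1 < size xs)%N by rewrite szxs.
by have := sorted_gtn_nth sxs lt; have := IH (ltnW lt_i); lia.
Qed.

Let entry_peel p i j : (i <= j)%N -> entry (peel p) (i, j) = entry p (i, j.+1).
Proof.
move=> le; rewrite entry_mkfilling => [|y]; last exact: entry_le.
rewrite mem_shift le /=; case: ifPn => // /entry_out -> //.
Qed.

Let glue_bound p : forall y : nat * nat,
  ((if y.1 == y.2 then minn m (nth 0 xs y.1 - (k - y.1.+1)) else
    @entry (shifted_diagram lam') m p (y.1, y.2.-1)) <= m)%N.
Proof. by move=> y; case: ifP => _; rewrite ?geq_minl ?entry_le. Qed.

Let entry_glue_diag p i : (i < k)%N ->
  entry (glue p) (i, i) = (nth 0 xs i - (k - i.+1))%N.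
Proof.
move=> lt; rewrite entry_mkfilling; last exact: glue_bound.
rewrite mem_shifted /= eqxx leqnn; have := lam_pos lt; have := xs_le lt.
by case: ifP; lia.
Qed.

Let entry_glue p i j : (i <= j)%N -> entry (glue p) (i, j.+1) = entry p (i, j).
Proof.
move=> le; rewrite entry_mkfilling; last exact: glue_bound.
rewrite /= ltn_eqF ?ltnS //; case: ifPn => // out.
by rewrite entry_out // mem_shift le.
Qed.

Let glueK p : peel (glue p) = p.
Proof.
apply: entry_inj => -[i j]; rewrite mem_shift => /andP[le _].
by rewrite entry_peel // entry_glue.
Qed.

Let sdiag_glue p : shifted_diagonal k (glue p) = xs.
Proof.
apply: (@eq_from_nth _ 0%N); rewrite size_mkseq // => i lt.
by rewrite nth_mkseq // entry_glue_diag // subnK ?xs_ge.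
Qed.

Let peelK p : shifted_diagonal k p = xs -> glue (peel p) = p.
Proof.
move=> dp; apply: entry_inj => -[i j]; rewrite mem_shifted => /andP[le lt].
have lt_ik : (i < k)%N by case: (ltnP i k) => // /lam_out E; rewrite E in lt; lia.
case: (ltngtP i j) le => // [lt_ij _|<- _].
  by case: j lt_ij lt => // j lt_ij _; rewrite entry_glue // entry_peel.
by rewrite entry_glue_diag // -dp nth_mkseq // addnK.
Qed.

(** Inequalities among the cells off the diagonal are just shifted; those that involve the diagonal
    say that the second diagonal interlaces with it. *)
Let glue_SPP p : (glue p \in SPP m lam) =
  (p \in SPP m lam') && (shifted_diagonal k p \in interlacing xs).
Proof.
have slam' : sorted gtn lam'.
  apply/(sortedP 0%N) => i; rewrite size_map => lt /=; rewrite !lamE.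
  by have := sorted_gtn_nth slam lt; have := lam_pos lt; lia.
apply/(SPP_entryP _ slam)/andP => [H|[/(SPP_entryP _ slam') H /mem_interlacing[_ Hd]]].
  split.
    apply/(SPP_entryP _ slam') => i j le; split=> [|lt].
      by have [+ _] := H i j.+1 (leqW le); rewrite !entry_glue // ?leqW.
    by have [_] := H i j.+1 (leqW le); rewrite !entry_glue //; apply.
  apply/mem_interlacing; rewrite size_mkseq szxs; split=> // i lt.
  rewrite nth_mkseq //; split=> [|lt1].
    have [+ _] := H i i (leqnn i); rewrite entry_glue // entry_glue_diag //.
    by have := xs_ge lt; lia.
  have [_ /(_ (ltnSn i))] := H i i.+1 (leqnSn i).
  by rewrite entry_glue_diag // entry_glue //; have := xs_ge lt1; have := xs_ge lt; lia.
move=> i j le; case: (ltnP i k) => [lt_ik|ge].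
  have [] := Hd i; rewrite szxs // nth_mkseq // => H1 H2.
  case: (ltngtP i j) le => // [lt_ij _|<- _].
    case: j lt_ij => // j lt_ij; have [H3 H4] := H i j lt_ij.
    rewrite (entry_glue p (leqW lt_ij : (i <= j.+1)%N)).
    rewrite (entry_glue p (lt_ij : (i <= j)%N)).
    split=> // _.
    case: (ltngtP i j) lt_ij => [lt_ij _|gt|eq_ij _].
    - by rewrite entry_glue //; apply: H4.
    - by rewrite ltnS leqNgt gt.
    (* The cell below (i, i + 1) would lie on the main diagonal, and here the strict lower bound of
       interlacing enters. *)
    rewrite -eq_ij; case: (ltnP i.+1 k) => [lt1|ge1].
      by rewrite entry_glue_diag //; have := H2 lt1; lia.
    by rewrite entry_out // mem_shifted lam_out //; lia.
  by rewrite entry_glue // entry_glue_diag //; split=> //; lia.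
by split=> [|_]; rewrite entry_out // mem_shifted lam_out //; lia.
Qed.

Let upper_volume_glue p : upper_volume (glue p) = volume p.
Proof.
rewrite /upper_volume /volume (sum_filling _ (fun x => x.1 < x.2)%N) ?uniq_shifted //.
rewrite (sum_filling _ xpredT) ?uniq_shifted // -big_filter.
rewrite (perm_big [seq (x.1, x.2.+1) | x <- shifted_diagram lam']); last first.
  apply: uniq_perm; first by rewrite filter_uniq ?uniq_shifted.
    by rewrite map_inj_uniq ?uniq_shifted // => -[? ?] [? ?] [-> ->].
  move=> [i j]; rewrite mem_filter /=; apply/andP/mapP => [[lt inD]|[[i' j']]].
    by case: j lt inD => // j lt inD; exists (i, j); rewrite // mem_shift -ltnS lt.
  by rewrite mem_shift => /andP[le inD] [-> ->].
rewrite big_map big_seq [RHS]big_seq; apply: eq_bigr => -[i j].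
by rewrite mem_shift => /andP[le _]; rewrite entry_glue.
Qed.

Lemma sum_SPP_peel (R : comNzRingType) (q : R) :
  \sum_(p in SPP m lam | shifted_diagonal k p == xs) q ^+ upper_volume p
  = \sum_(p in SPP m lam' | shifted_diagonal k p \in interlacing xs) q ^+ volume p.
Proof.
rewrite (reindex_onto glue peel) /=; last by move=> p /andP[_ /eqP/peelK].
apply: eq_big => [p|p _]; last by rewrite upper_volume_glue.
by rewrite glueK sdiag_glue !eqxx !andbT glue_SPP.
Qed.

End PeelDiagonal.

End ShiftedPlanePartitions.

Lemma sum_fibers (R : nmodType) (I : finType) (T : eqType) (P : pred I)
    (g : I -> T) (S : seq T) (f : I -> R) : uniq S ->
  \sum_(i | P i && (g i \in S)) f i = \sum_(y <- S) \sum_(i | P i && (g i == y)) f i.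
Proof.
elim: S => [|y S IH] /= => [_|/andP[yS uS]].
  by rewrite big_nil big_pred0 // => i; rewrite andbF.
rewrite big_cons -(IH uS) (bigID (fun i => g i == y)) /=; congr (_ + _).
  by apply: eq_bigl => i; rewrite inE -andbA; case: eqP; rewrite /= ?andbF ?andbT.
apply: eq_bigl => i; rewrite inE -andbA; case: eqP => [->|] /=.
  by rewrite (negbTE yS).
by rewrite andbT.
Qed.

(** A part 0 added to [lam] brings no cell, but it lengthens the diagonal by an entry 0 and so
    raises the shift of all earlier entries by one. *)
Lemma shifted_diagonal_size lam m (p : filling (shifted_diagram lam) m) :
  shifted_diagonal (size lam).+1 p
  = rcons [seq x.+1 | x <- shifted_diagonal (size lam) p] 0%N.
Proof.
rewrite /shifted_diagonal /mkseq -addn1 iotaD map_cat /= cats1 add0n.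
rewrite entry_out ?addn1 ?subnn; last by rewrite mem_shifted nth_default //; lia.
congr (rcons _ _); rewrite -map_comp; apply/eq_in_map => i.
by rewrite mem_iota /= => lt; lia.
Qed.

Lemma shifted_diagram_rcons0 lam : shifted_diagram (rcons lam 0%N) = shifted_diagram lam.
Proof.
rewrite /shifted_diagram size_rcons -[in LHS]addn1 iotaD map_cat flatten_cat /=.
rewrite nth_rcons ltnn eqxx /= cats0; congr flatten; apply/eq_in_map => i.
by rewrite mem_iota nth_rcons /= => ->.
Qed.

Lemma sorted_gtn_rcons0 lam : sorted gtn lam ->
  all (ltn 0) lam \/ exists2 lam', lam = rcons lam' 0%N & all (ltn 0) lam'.
Proof.
elim/last_ind: lam => [|lam x _] slam; first by left.
have alllt : all (ltn x) lam.
  move: slam; rewrite -cats1 sorted_pairwise; last exact: rev_trans ltn_trans.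
  by rewrite pairwise_cat allrel1r => /and3P[].
case: x slam alllt => [|x] slam alllt; first by right; exists lam.
left; rewrite all_rcons /=; apply: sub_all alllt => z /= lt; exact: leq_ltn_trans lt.
Qed.

Lemma sorted_gtn_map_succ (s : seq nat) : sorted gtn [seq x.+1 | x <- s] = sorted gtn s.
Proof. by rewrite sorted_map; apply: eq_sorted => x y. Qed.

(** * Shifted plane partitions with prescribed main diagonal *)

Section DeterminantFormula.
Variables (K : fieldType) (q : K) (m : nat).
Hypothesis q_neq0 : q != 0.

Definition hdet (k : nat) (lam xs : seq nat) : K :=
  rowsdet [seq jtrow k (fun i e => hsym q (nth 0%N lam i) e) x | x <- xs].

(** The last column belongs to a part 0, and a complete homogeneous sum in no variables is 1 in
    degree 0 and 0 otherwise. The column is therefore a unit vector with its 1 in the row x = 0, and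
    the determinant is expanded along it. *)
Lemma hdet_rcons0 lam xs : size xs = size lam ->
  hdet (size lam).+1 lam (rcons [seq x.+1 | x <- xs] 0%N) = hdet (size lam) lam xs.
Proof.
have lam_max : nth 0%N lam (@ord_max (size lam)) = 0%N by rewrite nth_default.
move=> szx; rewrite /hdet /rowsdet !size_map size_rcons size_map szx !eqxx.
rewrite (expand_det_col _ ord_max) big_ord_recr /= big1 => [|j _]; last first.
  rewrite !mxE (nth_map 0%N) ?size_rcons ?size_map ?szx /=;
    last exact: (leqW (ltn_ord j)).
  rewrite nth_rcons size_map szx ltn_ord (nth_map 0%N) ?szx //.
  by rewrite !mxE lam_max addnK /= if_same mul0r.
rewrite !mxE (nth_map 0%N) ?size_rcons ?size_map ?szx //=.
rewrite nth_rcons size_map szx ltnn eqxx !mxE lam_max /= add0n leqnn subnn.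
rewrite mul1r add0r /cofactor /= -signr_odd addnn odd_double mul1r.
congr (\det _); apply/matrixP => j i; rewrite !mxE !lift_max.
rewrite !(nth_map 0%N) ?size_rcons ?size_map ?szx // 1?leqW //.
rewrite nth_rcons size_map szx ltn_ord (nth_map 0%N) ?szx //.
by rewrite !mxE !lift_max addSn ltnS subSS.
Qed.

(** No row has x = 0, so the column of the part 0 vanishes. *)
Lemma hdet_pos lam xs : all (ltn 0) xs -> hdet (size lam).+1 lam xs = 0.
Proof.
have lam_max : nth 0%N lam (@ord_max (size lam)) = 0%N by rewrite nth_default.
move=> xs_gt0; rewrite /hdet /rowsdet !size_map; case: eqP => // szx.
rewrite (expand_det_col _ ord_max) big1 // => j _.
rewrite !mxE (nth_map 0%N) ?szx // !mxE lam_max addnK /=.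
have /= := all_nthP 0%N xs_gt0 j; rewrite szx => /(_ (ltn_ord j)).
by case: (nth _ _ _) => //= x _; rewrite if_same mul0r.
Qed.

(** The weight q^(sum of ys) goes into the entries as q^e by [rowsdet_jtrow_weight]. Summing over
    degrees is then the recursion of [hsym] that passes from lam_i - 1 to lam_i variables. *)
Lemma hdet_interlacing lam xs : all (ltn 0) lam -> sorted gtn xs ->
  q ^+ staircase (size lam) * hdet (size lam) lam xs
  = \sum_(ys <- interlacing xs)
      q ^+ sumn ys * hdet (size lam) (map predn lam) ys.
Proof.
move=> lam_gt0 sxs.
under eq_bigr => ys _ do rewrite -rowsdet_jtrow_weight.
rewrite -mulr_sumr; congr (_ * _).
rewrite (altform_interlacing _ (altform_rowsdet K _)) //; congr (rowsdet _).
apply: eq_map => x; rewrite sum_jtrow; apply/rowP => i; rewrite !mxE.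
case: ifP => // _; rewrite (nth_map 0%N) //.
by have /= := all_nthP 0%N lam_gt0 i (ltn_ord i); case: (nth _ _ _).
Qed.

Lemma SPP_diagonal_gf lam xs :
  sorted gtn lam -> size xs = size lam -> sorted gtn xs ->
  all (gtn (m + size lam)) xs ->
  \sum_(p in SPP m lam | shifted_diagonal (size lam) p == xs) q ^+ upper_volume p
  = hdet (size lam) lam xs.
Proof.
(* Lowering all parts by one decreases the sum, and dropping a last part 0 decreases the length. *)
have [n] := ubnP (sumn lam + size lam); elim: n lam xs => // n IH lam xs le_n.
move=> slam szx sxs lt_xs.
have [lam_gt0|[lam0 E lam0_gt0]] := sorted_gtn_rcons0 slam; last first.
  have slam0 : sorted gtn lam0.
    move: slam; rewrite E -cats1 => /cat_sorted2[] //.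
  rewrite E size_rcons in szx lt_xs le_n *; rewrite /SPP shifted_diagram_rcons0.
  have -> : hdet (size lam0).+1 (rcons lam0 0%N) xs = hdet (size lam0).+1 lam0 xs.
    rewrite /hdet; congr (rowsdet _); apply: eq_map => x; apply/rowP => i.
    rewrite !mxE (_ : nth 0%N (rcons lam0 0%N) i = nth 0%N lam0 i) // nth_rcons.
    by case: ltnP => // ge; rewrite nth_default // if_same.
  (* The shifted diagonal ends with 0, so both sides vanish unless [xs] does; if it does, this 0 is
     removed along with the part 0. *)
  have [xs_gt0|[xs0 E' xs0_gt0]] := sorted_gtn_rcons0 sxs.
    rewrite hdet_pos // big1 // => p /andP[_ /eqP]; rewrite shifted_diagonal_size => D.
    by move: xs_gt0; rewrite -D all_rcons.
  pose ys := map predn xs0; have E0 : xs0 = [seq x.+1 | x <- ys].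
    rewrite -map_comp -[LHS]map_id; apply/eq_in_map => x xin /=.
    by rewrite prednK //; apply: (allP xs0_gt0).
  have szy : size ys = size lam0 by move: szx; rewrite E' size_rcons E0 size_map => -[].
  rewrite E' E0 in sxs lt_xs *; rewrite hdet_rcons0 // -IH //.
  - apply: eq_bigl => p; congr (_ && _); rewrite shifted_diagonal_size.
    by rewrite eqseq_rcons eqxx andbT (inj_eq (inj_map succn_inj)).
  - by move: le_n; rewrite sumn_rcons; lia.
  - by move: sxs; rewrite -cats1 => /cat_sorted2[]; rewrite sorted_gtn_map_succ.
  - apply/allP => y yin /=; move: lt_xs; rewrite all_rcons => /andP[_ /allP].
    by move/(_ y.+1 (map_f _ yin)) ; rewrite /= => lt_y; lia.
case: (posnP (size lam)) => [/size0nil E|k_gt0].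
  rewrite E in szx *; rewrite (size0nil szx) /hdet /rowsdet /= det_mx00.
  have card1 : #|{: filling (shifted_diagram [::]) m}| = 1%N.
    by rewrite card_ffun card_seq_sub //= expn0.
  have /card1P[p0 p0P] : #|{: filling (shifted_diagram [::]) m}| == 1%N by apply/eqP.
  rewrite (big_pred1 p0) => [|p].
    rewrite (_ : upper_volume p0 = 0%N) // /upper_volume big1 // => -[b bD]; by [].
  have -> : pred1 p0 p by have := p0P p; rewrite !inE => <-.
  by rewrite inE andbT; apply/forallP => -[b bD].
set lam' := map predn lam.
have szl : size lam' = size lam by rewrite size_map.
have slam' : sorted gtn lam'.
  apply/(sortedP 0%N) => i; rewrite szl => lt /=.
  rewrite !(nth_map 0%N) //; last exact: ltnW.
  have := sorted_gtn_nth slam lt; have /= := all_nthP 0%N lam_gt0 _ lt; lia.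
have lt_sum : (sumn lam' < sumn lam)%N.
  rewrite /lam' {IH le_n slam szx lt_xs slam' szl lam'}.
  case: lam lam_gt0 k_gt0 => // x s /= /andP[x_gt0 _] _.
  have le : (sumn (map predn s) <= sumn s)%N by elim: s => //= y s; lia.
  by case: x x_gt0 => //= x _; rewrite addSn ltnS leq_add2l.
have lt_n : (sumn lam' + size lam' < n)%N by rewrite szl; lia.
(* The sum of ys exceeds the volume of the new main diagonal by the staircase, which this factor
   makes up for. *)
apply: (mulfI (expf_neq0 (staircase (size lam)) q_neq0)).
rewrite (sum_SPP_peel slam) // sum_fibers ?uniq_interlacing // hdet_interlacing //.
rewrite mulr_sumr big_seq [RHS]big_seq; apply: eq_bigr => ys /mem_interlacing[szy Hy].
rewrite -szl -IH //; last 3 first.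
- by rewrite szy szx szl.
- apply/(sortedP 0%N) => i; rewrite szy => lt /=.
  by have [_ /(_ lt)] := Hy i (ltnW lt); have [] := Hy _ lt; lia.
- apply/(all_nthP 0%N) => i; rewrite szy => lt /=.
  have [le _] := Hy i lt; rewrite szl; apply: leq_ltn_trans le _.
  exact: (all_nthP 0%N lt_xs).
rewrite !mulr_sumr; apply: eq_bigr => p /andP[_ /eqP D].
rewrite -!exprD -D -diag_volumeE volume_upper_diag; congr (_ ^+ _).
by rewrite addnCA [RHS]addnC [(diag_volume p + _)%N]addnC.
Qed.

End DeterminantFormula.

(** * Complete homogeneous sums as q-binomial coefficients *)

Section QBinomials.
Variables (K : fieldType) (q : K).
Hypothesis q_unity : forall n, (0 < n)%N -> q ^+ n != 1.

Lemma q_neq1 : 1 - q != 0.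
Proof. by rewrite subr_eq0 eq_sym -[q]expr1 q_unity. Qed.

Lemma qint_neq0 n : qint q n.+1 != 0.
Proof. by rewrite mulf_neq0 ?invr_neq0 ?q_neq1 // subr_eq0 eq_sym q_unity. Qed.

Lemma qintD a b : qint q (a + b) = qint q a + q ^+ a * qint q b.
Proof. by rewrite /qint exprD; field; rewrite q_neq1. Qed.

Lemma qfactS n : qfact q n.+1 = qfact q n * qint q n.+1.
Proof. by rewrite /qfact big_nat_recr. Qed.

Lemma qfact_neq0 n : qfact q n != 0.
Proof.
elim: n => [|n IH]; first by rewrite /qfact big_geq ?oner_neq0.
by rewrite qfactS mulf_neq0 ?qint_neq0.
Qed.

Lemma qfact0 : qfact q 0 = 1.
Proof. by rewrite /qfact big_geq. Qed.

(** Splitting off the last term of the sum over degrees gives the q-Pascal recursion, and [n+e+2] =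
    [e+1] + q^(e+1) [n+1] shows that the quotient of q-factorials satisfies it. *)
Lemma hsymE n e : hsym q n.+1 e = qfact q (n + e) / (qfact q n * qfact q e).
Proof.
elim: n e => [|n IHn] e.
  rewrite qfact0 mul1r divff ?qfact_neq0 //= big_ord_recl /= !mulr1 big1 ?addr0 // => i _.
  by rewrite mulr0.
elim: e => [|e IHe].
  by rewrite /= big_ord1 -/(hsym q n.+1 0) mul1r IHn !addn0 qfact0 !mulr1 !divff ?qfact_neq0.
have -> : hsym q n.+2 e.+1 = hsym q n.+2 e + q ^+ e.+1 * hsym q n.+1 e.+1.
  by rewrite [LHS]big_ord_recr.
rewrite IHe IHn !addSn !addnS !qfactS.
have -> : qint q (n + e).+2 = qint q e.+1 + q ^+ e.+1 * qint q n.+1.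
  by rewrite -qintD; congr (qint q _); lia.
by field; rewrite !qfact_neq0 !qint_neq0.
Qed.

Lemma qbinom_hsym n (d : nat) : (0 < n)%N ->
  qbinom q (n%:Z - 1 + d%:Z) d%:Z = hsym q n d.
Proof.
case: n => // n _; rewrite hsymE /qbinom.
have -> : (n.+1%:Z - 1 + d%:Z = (n + d)%:Z) by lia.
have -> : ((n + d)%:Z - d%:Z = n%:Z) by lia.
by rewrite lez_nat leq_addl /= [qfact q d * _]mulrC.
Qed.

End QBinomials.

(** * The generating function as a sum of maximal minors *)

Section GeneratingFunction.
Variables (K : fieldType) (q t : K) (m : nat) (lam : seq nat).
Hypotheses (q_unity : forall n, (0 < n)%N -> q ^+ n != 1).
Hypotheses (q_neq0 : q != 0) (t_neq0 : t != 0) (slam : strict_partition lam).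
Let k := size lam.

Lemma shifted_diagonal_decreasing (p : filling (shifted_diagram lam) m) :
  p \in SPP m lam -> shifted_diagonal k p \in decreasing_seqs (m + k).
Proof.
have slam' : sorted gtn lam by case/andP: slam.
move=> /(SPP_entryP _ slam') H; rewrite mem_decreasing_seqs; apply/andP; split.
  apply/(sortedP 0%N) => i; rewrite size_mkseq => lt /=.
  rewrite !nth_mkseq //; last exact: ltnW.
  (* Two diagonal neighbours are compared through the cell (i, i + 1), right of the first and above
     the second. *)
  have [H1 _] := H i i (leqnn i); have [_ /(_ (ltnSn i)) H2] := H i i.+1 (leqnSn i).
  by have := leq_trans H2 H1; lia.
apply/(all_nthP 0%N) => i; rewrite size_mkseq => lt /=; rewrite nth_mkseq //.
by have := entry_le p (i, i); lia.
Qed.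

(** Column j corresponds to x = m + k - 1 - j, for which the degree x + i - (k - 1) is m + i - j;
    from left to right, x runs downwards. *)
Lemma Mmat_cols : [seq row j (Mmat m lam q t)^T | j <- enum 'I_(m + k)]
  = [seq jtrow k (fun i e => t ^+ e * hsym q (nth 0%N lam i) e) x
    | x <- rev (iota 0 (m + k))].
Proof.
apply: (@eq_from_nth _ 0) => [|j].
  by rewrite size_map size_enum_ord size_map size_rev size_iota.
rewrite size_map size_enum_ord => lt.
have := nth_cols (Mmat m lam q t) (Ordinal lt) => /= ->.
rewrite (nth_map 0%N) ?size_rev ?size_iota // nth_rev ?size_iota // nth_iota; last by lia.
apply/rowP => i; rewrite !mxE /= add0n; have lt_i := ltn_ord i.
case: leqP => [le|gt].
  set d := (m + k - j.+1 + i.+1 - k)%N.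
  have -> : (m%:Z + (i : nat)%:Z - j%:Z = d%:Z) by rewrite /d /k in le lt lt_i *; lia.
  rewrite qbinom_hsym //; apply: (all_nthP 0%N _ _ lt_i); by case/andP: slam.
(* For negative m + i - j the power of t is an inverse, but the q-binomial coefficient is 0. *)
rewrite /qbinom; case: ifP => [H|_]; last by rewrite mulr0.
by exfalso; move: H gt lt lt_i; rewrite /k; lia.
Qed.

(** The elements of [SPP] are grouped by shifted main diagonal, that is, by a choice of k columns.
    The factor t^staircase, cancelled since t is nonzero, accounts for the shift. *)
Lemma SPP_gf2_minorsum : SPP_gf2 m lam q t = minorsum (Mmat m lam q t).
Proof.
have slam' : sorted gtn lam by case/andP: slam.
apply: (mulfI (expf_neq0 (staircase k) t_neq0)).
rewrite /minorsum Mmat_cols subsum_decreasing /SPP_gf2.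
rewrite (eq_bigl (fun p => (p \in SPP m lam) &&
   (shifted_diagonal k p \in decreasing_seqs (m + k)))); last first.
  by move=> p; case: (boolP (p \in _)) => //= /shifted_diagonal_decreasing ->.
rewrite sum_fibers ?uniq_decreasing_seqs // !mulr_sumr big_seq [RHS]big_seq.
apply: eq_bigr => xs; rewrite mem_decreasing_seqs => /andP[sxs lt_xs].
rewrite rowsdet_jtrow_weight.
(* A sequence of another length is no shifted diagonal, and [rowsdet] is 0 on it. *)
case: (eqVneq (size xs) k) => [szx|szx]; last first.
  rewrite /rowsdet size_map (negbTE szx) mulr0 big1 ?mulr0 // => p /andP[_ /eqP D].
  by rewrite -D size_mkseq eqxx in szx.
rewrite -/(hdet q k lam xs) -(@SPP_diagonal_gf _ _ m q_neq0) // !mulr_sumr.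
apply: eq_bigr => p /andP[_ /eqP <-]; rewrite -diag_volumeE exprD.
by ring.
Qed.

Theorem SPP_gf2_sqr : SPP_gf2 m lam q t ^+ 2
  = \det (Mmat m lam q t *m Umat K (m + size lam) *m (Mmat m lam q t)^T).
Proof. by rewrite SPP_gf2_minorsum minorsum_sqr. Qed.

End GeneratingFunction.

Lemma SPP_gf_gf2 (R : nzSemiRingType) (q : R) m lam :
  SPP_gf m lam q = SPP_gf2 m lam q q.
Proof. by apply: eq_bigr => p _; rewrite -exprD volume_upper_diag. Qed.

(** * Symmetric plane partitions of the doubled shape *)

Lemma uniq_young mu : uniq (young_diagram mu).
Proof.
apply: allpairs_uniq_dep => [|i _|]; try exact: iota_uniq.
by move=> [i j] [i' j'] _ _ /= [-> ->].
Qed.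

Lemma weakly_decreasing_youngP mu m (p : filling (young_diagram mu) m) :
  int_partition mu ->
  reflect (forall i j, (entry p (i.+1, j) <= entry p (i, j))%N
                    /\ (entry p (i, j.+1) <= entry p (i, j))%N)
          (weakly_decreasing p).
Proof.
move=> pmu; apply: (iffP forallP) => [wp i j|H b].
  split.
    case: (boolP ((i.+1, j) \in young_diagram mu)) => [inD|/entry_out -> //].
    have inD' : (i, j) \in young_diagram mu.
      by move: inD; rewrite !mem_young => lt;
        apply: leq_trans (partition_nth pmu (leqnSn i)).
    have /forallP/(_ (SeqSub inD)) := wp (SeqSub inD').
    by rewrite /= eqxx /= -!entryE.
  case: (boolP ((i, j.+1) \in young_diagram mu)) => [inD|/entry_out -> //].
  have inD' : (i, j) \in young_diagram mu by move: inD; rewrite !mem_young; lia.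
  have /forallP/(_ (SeqSub inD)) := wp (SeqSub inD').
  by rewrite /= eqxx orbT /= -!entryE.
apply/forallP => c; apply/implyP; rewrite -!entryE.
case: (val b) (val c) => i j [i' j'] /= /orP[] /eqP[-> ->].
  exact: (H i j).1.
exact: (H i j).2.
Qed.

Section Doubling.
Variables (m : nat) (lam : seq nat).
Hypothesis slam : strict_partition lam.
Let mu := doubling lam.

Local Notation SF := (filling (shifted_diagram lam) m).
Local Notation YF := (filling (young_diagram mu) m).

Let fold (p : YF) : SF := mkfilling _ m (entry p).
Let unfold (p : SF) : YF := mkfilling _ m (fun x => entry p (minn x.1 x.2, maxn x.1 x.2)).

Let pmu : int_partition mu.
Proof. by case: (is_doubling_doubling slam) => [[]]. Qed.

Let mem_sym i j : ((i, j) \in young_diagram mu) = ((j, i) \in young_diagram mu).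
Proof. by case: (is_doubling_doubling slam) => [[]]. Qed.

Let mem_upper i j : (i <= j)%N ->
  ((i, j) \in young_diagram mu) = ((i, j) \in shifted_diagram lam).
Proof.
have [_ rows /(durfeeP _ pmu)[_ dk]] := is_doubling_doubling slam.
move=> le; rewrite mem_young mem_shifted le /=; case: (ltnP i (size lam)) => [/rows -> //|ge].
(* Below the Durfee square a row has at most [size lam] boxes, so none on the diagonal or to its
   right. *)
rewrite [nth 0%N lam i]nth_default //; have := partition_nth pmu ge.
by rewrite -/mu in dk *; lia.
Qed.

Let entry_fold p i j : (i <= j)%N -> entry (fold p) (i, j) = entry p (i, j).
Proof.
move=> le; rewrite entry_mkfilling => [|y]; last exact: entry_le.
by rewrite -mem_upper //; case: ifPn => // /entry_out ->.
Qed.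

Let entry_unfold p i j : entry (unfold p) (i, j) = entry p (minn i j, maxn i j).
Proof.
rewrite entry_mkfilling => [|y]; last exact: entry_le.
case: ifPn => //= out; rewrite entry_out //; apply: contra out => inD.
have le : (minn i j <= maxn i j)%N by lia.
move: inD; rewrite -mem_upper //.
by case: (leqP i j) => [_|_]; rewrite // mem_sym.
Qed.

Let unfoldK p : fold (unfold p) = p.
Proof.
apply: entry_inj => -[i j]; rewrite mem_shifted => /andP[le _].
by rewrite entry_fold // entry_unfold (minn_idPl le) (maxn_idPr le).
Qed.

Let entry_sym (p : YF) : p \in PPsym m mu -> forall i j, entry p (i, j) = entry p (j, i).
Proof.
rewrite inE => /andP[_ /forallP H] i j.
case: (boolP ((i, j) \in young_diagram mu)) => [inD|out]; last first.
  by rewrite !entry_out // -mem_sym.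
have inD' : (j, i) \in young_diagram mu by rewrite -mem_sym.
have /forallP/(_ (SeqSub inD')) := H (SeqSub inD); rewrite /= eqxx /= => /eqP E.
by have := entryE p (SeqSub inD); have := entryE p (SeqSub inD'); rewrite /= E => -> ->.
Qed.

Let foldK p : p \in PPsym m mu -> unfold (fold p) = p.
Proof.
move=> pP; apply: entry_inj => -[i j] _; rewrite entry_unfold entry_fold; last by lia.
by case: (leqP i j) => // _; rewrite (entry_sym pP).
Qed.

Let unfold_PPsym p : (unfold p \in PPsym m mu) = (p \in SPP m lam).
Proof.
have slam' : sorted gtn lam by case/andP: slam.
rewrite inE; have -> : [forall b, forall c, (val c == ((val b).2, (val b).1)) ==>
    (unfold p b == unfold p c)].
  apply/forallP => b; apply/forallP => c; apply/implyP => /eqP E.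
  rewrite -val_eqE /= -!entryE E; case: (val b) => i j /=.
  by rewrite !entry_unfold minnC maxnC.
rewrite andbT; apply/(weakly_decreasing_youngP _ pmu)/(SPP_entryP _ slam') => H i j.
  move=> le; have [H1 H2] := H i j; move: H1 H2; rewrite !entry_unfold.
  rewrite (minn_idPl le) (maxn_idPr le) (minn_idPl (leqW le)) (maxn_idPr (leqW le)).
  by move=> H1 H2; split=> // lt; move: H1; rewrite (minn_idPl lt) (maxn_idPr lt).
rewrite !entry_unfold; case: (ltngtP i j) => [lt|lt|<-].
- have [H1 /(_ lt) H2] := H i j (ltnW lt).
  by rewrite (minn_idPl lt) (maxn_idPr lt)
    (minn_idPl (ltnW (leqW lt))) (maxn_idPr (ltnW (leqW lt))).
- have [H1 /(_ lt) H2] := H j i (ltnW lt).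
  by rewrite (minn_idPr lt) (maxn_idPl lt)
    (minn_idPr (ltnW (leqW lt))) (maxn_idPl (ltnW (leqW lt))).
have [H1 _] := H i i (leqnn i).
by rewrite (minn_idPl (leqnSn i)) (maxn_idPr (leqnSn i))
  (minn_idPr (leqnSn i)) (maxn_idPl (leqnSn i)).
Qed.

(** The cells below the diagonal mirror those above it, whence the weights q^2 off the diagonal and
    q on it in [PPsym_gf_SPP_gf2]. *)
Let volume_unfold p : volume (unfold p) = (2 * upper_volume p + diag_volume p)%N.
Proof.
rewrite /volume /upper_volume /diag_volume.
rewrite (sum_filling _ xpredT) ?uniq_young //.
rewrite (sum_filling _ (fun x => x.1 < x.2)%N) ?uniq_shifted //.
rewrite (sum_filling _ (fun x => x.1 == x.2)) ?uniq_shifted //.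
have sumE (P : pred (nat * nat)) : (forall i j, P (i, j) -> (i <= j)%N) ->
    (\sum_(x <- young_diagram mu | P x) entry (unfold p) x
     = \sum_(x <- shifted_diagram lam | P x) entry p x)%N.
  move=> Ple; rewrite -big_filter -[RHS]big_filter.
  rewrite (perm_big [seq x <- shifted_diagram lam | P x]).
    rewrite big_seq [RHS]big_seq; apply: eq_bigr => -[i j].
    rewrite mem_filter => /andP[/Ple le _].
    by rewrite entry_unfold (minn_idPl le) (maxn_idPr le).
  apply: uniq_perm; rewrite ?filter_uniq ?uniq_young ?uniq_shifted // => -[i j].
  rewrite !mem_filter; case Pij: (P (i, j)) => //=; exact: mem_upper (Ple _ _ Pij).
have -> : (\sum_(x <- young_diagram mu) entry (unfold p) x =
    \sum_(x <- young_diagram mu | x.1 < x.2) entry (unfold p) x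
    + (\sum_(x <- young_diagram mu | x.1 == x.2) entry (unfold p) x
       + \sum_(x <- young_diagram mu | x.2 < x.1) entry (unfold p) x))%N.
  rewrite (bigID (fun x : nat * nat => x.1 < x.2)%N) /=; congr addn.
  rewrite (bigID (fun x : nat * nat => x.1 == x.2)) /=.
  by congr addn; apply: eq_bigl => -[i j] /=; lia.
have -> : (\sum_(x <- young_diagram mu | x.2 < x.1) entry (unfold p) x
    = \sum_(x <- young_diagram mu | x.1 < x.2) entry (unfold p) x)%N.
  rewrite -big_filter -[RHS]big_filter.
  rewrite (perm_big [seq (x.2, x.1) | x <- young_diagram mu & (x.1 < x.2)%N]).
    by rewrite big_map; apply: eq_bigr => -[i j] _ /=; rewrite !entry_unfold minnC maxnC.
  apply: uniq_perm; rewrite ?filter_uniq ?uniq_young //.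
    by rewrite map_inj_uniq ?filter_uniq ?uniq_young // => -[? ?] [? ?] [-> ->].
  move=> [i j]; rewrite mem_filter /=; apply/andP/mapP => [[lt inD]|[[i' j']]].
    by exists (j, i); rewrite // mem_filter /= lt -mem_sym.
  by rewrite mem_filter /= => /andP[lt inD] [-> ->]; rewrite lt -mem_sym.
rewrite !sumE; [|by move=> i j /eqP /= ->|by move=> i j /ltnW].
by rewrite mul2n -addnn addnCA addnC.
Qed.

Lemma PPsym_gf_SPP_gf2 (R : comNzRingType) (q : R) :
  PPsym_gf m mu q = SPP_gf2 m lam (q ^+ 2) q.
Proof.
rewrite /PPsym_gf (reindex_onto unfold fold) /=; last by move=> p /foldK.
apply: eq_big => [p|p _]; first by rewrite unfoldK eqxx andbT unfold_PPsym.
by rewrite volume_unfold exprD exprM.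
Qed.

End Doubling.

(** * The indeterminates in the field of rational functions *)

Lemma tofracX_unity (R : idomainType) (a : R) (n : nat) : a ^+ n != 1 ->
  (tofrac a : {fraction R}) ^+ n != 1.
Proof. by rewrite -rmorphXn -(rmorph1 (@tofrac R)) tofrac_eq. Qed.

Lemma polyX_unity (R : idomainType) n : (0 < n)%N -> ('X : {poly R}) ^+ n != 1.
Proof.
case: n => // n _; apply/eqP => /(congr1 (fun p : {poly R} => size p)).
by rewrite size_polyXn size_poly1.
Qed.

Lemma sqr_unity (K : fieldType) (q : K) : (forall n, (0 < n)%N -> q ^+ n != 1) ->
  forall n, (0 < n)%N -> (q ^+ 2) ^+ n != 1.
Proof. by move=> uq n n_gt0; rewrite -exprM uq // muln_gt0. Qed.

Lemma q_unity n : (0 < n)%N -> q_ ^+ n != 1.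
Proof.
move=> n_gt0; apply: tofracX_unity; rewrite -rmorphXn /= -[1]/(1%:P).
by rewrite (inj_eq (@polyC_inj _)) polyX_unity.
Qed.

Theorem theorem4p4 (m : nat) (lam : seq nat) :
  (0 < m)%N -> strict_partition lam ->
  [/\ SPP_gf2 m lam q_ t_ ^+ 2
        = \det (Mmat m lam q_ t_ *m Umat Qqt (m + size lam)
                *m (Mmat m lam q_ t_)^T),
      SPP_gf m lam q_ ^+ 2
        = \det (Mmat m lam q_ q_ *m Umat Qqt (m + size lam)
                *m (Mmat m lam q_ q_)^T)
    & PPsym_gf m (doubling lam) q_ ^+ 2
        = \det (Mmat m lam (q_ ^+ 2) q_ *m Umat Qqt (m + size lam)
                *m (Mmat m lam (q_ ^+ 2) q_)^T)].
Proof.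
move=> _ slam.
have q0 : q_ != 0 by rewrite tofrac_eq0 polyC_eq0 polyX_eq0.
have t0 : t_ != 0 by rewrite tofrac_eq0 polyX_eq0.
split.
- exact: (SPP_gf2_sqr m q_unity q0 t0 slam).
- by rewrite SPP_gf_gf2; exact: (SPP_gf2_sqr m q_unity q0 q0 slam).
by rewrite (PPsym_gf_SPP_gf2 m slam);
  exact: (SPP_gf2_sqr m (sqr_unity q_unity) (expf_neq0 2 q0) q0 slam).
Qed.
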